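(* Let $G$ be a locally compact group, let $A$ be a compact abelian group (written additively), and let $\omega\colon G\times G\to A$ be a normalized Borel 2-cocycle of $G$ over $A$. Suppose that $\omega$ is continuous, or that $G$ and $A$ are second countable. Then $G$ is almost unimodular if and only if $A\rtimes_{(1,\omega)}G$ is almost unimodular.
   Context: All groups are Hausdorff. A locally compact group is almost unimodular if the kernel of its modular function is open. A normalized Borel 2-cocycle of $G$ over $A$ is a Borel map $\omega\colon G\times G\to A$ with $\omega(e,s)=\omega(s,e)=0$ and $\omega(s,t)+\omega(st,r)=\omega(t,r)+\omega(s,tr)$ for all $s,t,r\in G$. $A\rtimes_{(1,\omega)}G$ is the set $A\times G$ with the group operations $(a,s)(b,t)=(a+b+\omega(s,t),st)$ and $(a,s)^{-1}=(-a-\omega(s,s^{-1}),s^{-1})$. When $\omega$ is continuous, it carries the product topology. When $G$ and $A$ are second countable, it carries the unique (Weil/Mackey) locally compact second countable group topology whose Borel structure is the product Borel structure. In both cases a left Haar measure is $\mu_A\times\mu_G$, where $\mu_A$ is the normalized Haar measure on $A$ and $\mu_G$ is a left Haar measure on $G$. *)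

(* Defs.v *)
From HB Require Import structures.
From mathcomp Require Import all_boot all_order all_algebra.
From mathcomp Require Import all_classical all_reals all_analysis.

Set Implicit Arguments.
Unset Strict Implicit.
Unset Printing Implicit Defensive.

Import Order.TTheory GRing.Theory Num.Theory.

Local Open Scope classical_set_scope.

Definition borel (T : topologicalType) : set (set T) := <<s @open T >>.

Definition borel_fun (T U : topologicalType) (f : T -> U) : Prop :=
  forall B, borel B -> borel (f @^-1` B).

(* No compatibility between the two structures is required here; it is the
   predicate [topological_group]. *)
#[short(type="preTopologicalGroupType")]
HB.structure Definition PreTopologicalGroup :=
  {G of Topological G & Group G}.

Definition topological_group (G : preTopologicalGroupType) : Prop :=
  continuous (fun x : G * G => x.1 * x.2)%g /\
  continuous (fun x : G => x^-1)%g.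

Definition locally_compact_group (G : preTopologicalGroupType) : Prop :=
  [/\ topological_group G, hausdorff_space G & locally_compact [set: G]].

(* [G] as a measurable type for its Borel sets. The point is only there because
   the library requires measurable types to be pointed. *)
Definition borel_group (G : preTopologicalGroupType) : Type := G.

Section borel_group.
Variable G : preTopologicalGroupType.

HB.instance Definition _ := Choice.on (borel_group G).
HB.instance Definition _ := isPointed.Build (borel_group G) (1%g : G).
HB.instance Definition _ := @isMeasurable.Build (sigma_display (@open G))
  (borel_group G) (@borel G) (@sigma_algebra0 _ setT (@open G))
  (@sigma_algebraC (borel_group G) (@open G))
  (@sigma_algebra_bigcup _ setT (@open G)).

End borel_group.

Local Open Scope ring_scope.
Local Open Scope ereal_scope.

Section haar.
Variables (R : realType) (G : preTopologicalGroupType).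
Implicit Type mu : {measure set (borel_group G) -> \bar R}.

Definition radon_measure mu : Prop :=
  [/\ forall K : set G, compact K -> mu K < +oo,
      forall B : set G, borel B ->
        mu B = ereal_inf [set mu U | U in [set U : set G | open U /\ B `<=` U]] &
      forall U : set G, open U ->
        mu U = ereal_sup [set mu K | K in [set K : set G | compact K /\ K `<=` U]]].

Definition left_invariant mu : Prop :=
  forall (s : G) (B : set G), borel B -> mu [set (s * x)%g | x in B] = mu B.

Definition left_haar_measure mu : Prop :=
  [/\ radon_measure mu, left_invariant mu & mu [set: G] != 0].

(* By existence and uniqueness of the left Haar measure up to a positive
   scalar, a locally compact group has exactly one modular function. Some
   authors use its inverse, which has the same kernel. *)
Definition modular_function (Delta : G -> R) : Prop :=
  exists2 mu : {measure set (borel_group G) -> \bar R}, left_haar_measure mu &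
    forall (s : G) (B : set G), borel B ->
      mu [set (x * s)%g | x in B] = (Delta s)%:E * mu B.

Definition almost_unimodular : Prop :=
  exists2 Delta : G -> R, modular_function Delta &
    open [set s | Delta s = 1%R].

End haar.

Local Close Scope ereal_scope.

Record normalized_borel_cocycle (G : preTopologicalGroupType)
    (A : topologicalZmodType) := NormalizedBorelCocycle {
  cocycle_fun :> G * G -> A ;
  cocycle_borel : borel_fun cocycle_fun ;
  cocycle1s : forall s, cocycle_fun (1%g, s) = 0 ;
  cocycles1 : forall s, cocycle_fun (s, 1%g) = 0 ;
  cocycleE : forall s t r,
    cocycle_fun (s, t) + cocycle_fun ((s * t)%g, r) =
    cocycle_fun (t, r) + cocycle_fun (s, (t * r)%g) }.

(* The group [A ><|_(1, omega) G], without a topology. *)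
Definition twisted_product (G : preTopologicalGroupType)
    (A : topologicalZmodType) (omega : normalized_borel_cocycle G A) : Type :=
  (A * G)%type.

Section twisted_product.
Variables (G : preTopologicalGroupType) (A : topologicalZmodType).
Variable omega : normalized_borel_cocycle G A.

Let E : Type := twisted_product omega.

Definition twisted_one : E := (0, 1%g).

Definition twisted_mul (x y : E) : E :=
  (x.1 + y.1 + omega (x.2, y.2), (x.2 * y.2)%g).

Definition twisted_inv (x : E) : E :=
  (- x.1 - omega (x.2, x.2^-1%g), x.2^-1%g).

Fact twisted_mulA : associative twisted_mul.
Proof.
move=> [a s] [b t] [c r]; congr pair => /=; last exact: mulgA.
have h := cocycleE omega s t r.
rewrite -!addrA; congr (a + _); congr (b + _).
by rewrite -h addrCA.
Qed.

Fact twisted_mul1 : left_id twisted_one twisted_mul.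
Proof.
by move=> [a s]; rewrite /twisted_mul /= add0r cocycle1s addr0 mul1g.
Qed.

Fact twisted_mulr1 : right_id twisted_one twisted_mul.
Proof.
by move=> [a s]; rewrite /twisted_mul /= addr0 cocycles1 addr0 mulg1.
Qed.

Fact cocycleVs (s : G) : omega (s^-1%g, s) = omega (s, s^-1%g).
Proof.
have := cocycleE omega s s^-1%g s.
by rewrite mulgV mulVg cocycle1s cocycles1 !addr0.
Qed.

Fact twisted_mulV : left_inverse twisted_one twisted_inv twisted_mul.
Proof.
move=> [a s]; rewrite /twisted_mul /twisted_inv /=; congr pair.
  by rewrite cocycleVs addrAC subrK addNr.
exact: mulVg.
Qed.

Fact twisted_mulrV : right_inverse twisted_one twisted_inv twisted_mul.
Proof.
move=> [a s]; rewrite /twisted_mul /twisted_inv /=; congr pair.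
  by rewrite addrA subrr add0r addNr.
exact: mulgV.
Qed.

HB.instance Definition _ := Choice.copy (twisted_product omega) (A * G)%type.
HB.instance Definition _ := isGroup.Build (twisted_product omega)
  twisted_mulA twisted_mul1 twisted_mulr1 twisted_mulV twisted_mulrV.

End twisted_product.

Record topology (T : Type) := Topology {
  opens :> set (set T) ;
  opens_setT : opens setT ;
  opens_setI : setI_closed opens ;
  opens_bigcup : forall (I : Type) (f : I -> set T),
    (forall i, opens (f i)) -> opens (\bigcup_i f i) }.

Definition topologized (G : groupType) (tau : topology G) : Type := G.

Section topologized.
Variables (G : groupType) (tau : topology G).

HB.instance Definition _ := Group.on (topologized tau).
HB.instance Definition _ := isOpenTopological.Build (topologized tau)
  (@opens_setT G tau) (@opens_setI G tau) (@opens_bigcup G tau).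

End topologized.

Section twisted_topology.
Variables (G : preTopologicalGroupType) (A : topologicalZmodType).
Variable omega : normalized_borel_cocycle G A.

Definition is_product_topology (tau : topology (twisted_product omega)) : Prop :=
  opens tau = @open (A * G)%type.

Definition product_borel : set (set (A * G)) :=
  <<s [set B `*` C | B in @borel A & C in @borel G] >>.

(* The Weil-Mackey topology; it is unique with these properties. *)
Definition is_mackey_topology (tau : topology (twisted_product omega)) : Prop :=
  [/\ locally_compact_group (topologized tau),
      @second_countable (topologized tau) &
      @borel (topologized tau) = product_borel].

End twisted_topology.

(* Main.v *)
(* Haar measures exist on every locally compact group (limits of covering
   numbers along an ultrafilter give a content on compact sets, and a content
   extends to a Radon measure), in particular on [A] and on the extension [E].

   The guiding formula is that [Q B := \int_s muA (B_s) dmuG], where [B_s] is the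
   fiber of [B] over [s], is left invariant on [E] and that right translation by
   [(a, t)] scales it by [Delta_G t]: hence [Delta_E (a, t) = Delta_G t] and the
   kernel of [Delta_E] is [A * ker Delta_G].

   If [omega] is continuous, [Q] is a content on the compact sets of [A * G],
   which yields a Haar measure of [E]; conversely a Haar measure of [E] is pushed
   forward along the projection [E -> G], which is proper as [A] is compact.

   For the Mackey topology, [Q] is a sigma-finite left invariant Borel measure on
   [E], so it is proportional to any Haar measure of [E]. Neither the projection
   nor the inclusions are known to be continuous here, but one kernel is open iff
   the other one is: an open subgroup of a second countable group has countable
   index, and a Borel subgroup of countable index has positive Haar measure, so
   that it is open by the theorem of Steinhaus. *)

Require Import Defs.
From HB Require Import structures.
From mathcomp Require Import all_boot all_order all_algebra.
From mathcomp Require Import all_classical all_reals all_analysis.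
From mathcomp Require Import measurable_realfun.

Set Implicit Arguments.
Unset Strict Implicit.
Unset Printing Implicit Defensive.

Import Order.TTheory GRing.Theory Num.Theory.
Import numFieldNormedType.Exports.

Local Open Scope classical_set_scope.

(** * Compact sets *)

Section compact_lemmas.
Variable X : topologicalType.
Implicit Types (A B K U V : set X) (F : set_system X).

(** Near-covering compactness is applied to the filter of finite sequences directed by inclusion:
    around a point [x], every sequence that contains [x] works. The points of [s] may lie outside
    [K]. *)
Lemma compact_seq_subcover K (f : X -> set X) :
  compact K -> (forall x, K x -> nbhs x (f x)) ->
  exists s : seq X, K `<=` \bigcup_(x in [set` s]) f x.
Proof.
move=> /compact_near_coveringP cK fK.
pose F := filter_from [set: seq X] (fun s => [set t : seq X | {subset s <= t}]).
have FF : Filter F.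
  apply: filter_from_filter; first by exists [::].
  move=> s t _ _; exists (s ++ t) => // u st; split=> x xs; apply: st;
    by rewrite mem_cat xs ?orbT.
have [|s _] := cK _ F (fun s x => (\bigcup_(y in [set` s]) f y) x) FF.
  move=> x Kx; exists (f x, [set t | x \in t]) => /=.
    split; [exact: fK|exists [:: x] => // t /= st; apply: st; exact: mem_head].
  by move=> [y t] /= [fy xt]; exists x.
by move=> /(_ s) /= sK; exists s; apply: sK.
Qed.

Lemma compact_nondecreasing_cover K (U : (set X)^nat) :
  compact K -> (forall n, open (U n)) -> nondecreasing_seq U ->
  K `<=` \bigcup_n U n -> exists n, K `<=` U n.
Proof.
move=> /compact_near_coveringP cK oU ndU KU.
have [|n _] := cK _ \oo (fun n x => U n x) _.
  move=> x /KU [n _ Unx]; exists (U n, [set m | (n <= m)%N]) => /=.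
    by split; [exact: open_nbhs_nbhs|exists n].
  by move=> [y m] /= [Uy nm]; move: y Uy; apply/subsetPset/ndU.
by move=> /(_ n (leqnn n)) Kn; exists n.
Qed.

(** Finitely many of the sets [W] cover [B], and the matching members of [F] are intersected. A
    general filter allows two uses in a row: with the neighbourhoods of a point, then with those of
    a compact set. *)
Lemma compact_filter_separation F B : Filter F -> compact B ->
  (forall b, B b -> exists W U, [/\ open W, W b, F U & U `&` W = set0]) ->
  exists V U, [/\ open V, B `<=` V, F U & U `&` V = set0].
Proof.
move=> FF cB sepB.
have /choice [f fP] (x : X) : exists W : set X,
    (B x -> W x) /\ [/\ open W & exists2 U, F U & U `&` W = set0].
  have [Bx|nBx] := pselect (B x).
    have [W [U [oW Wx FU UW]]] := sepB _ Bx.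
    by exists W; split => //; split => //; exists U.
  by exists set0; split => //; split; [exact: open0|exists setT;
    [exact: filterT|rewrite setI0]].
have [s sB] := @compact_seq_subcover B f cB (fun x Bx =>
  open_nbhs_nbhs (conj (fP x).2.1 ((fP x).1 Bx))).
exists (\bigcup_(x in [set` s]) f x).
suff [U FU Us] : exists2 U, F U & U `&` \bigcup_(x in [set` s]) f x = set0.
  by exists U; split => //; apply: bigcup_open => x _; have [_ []] := fP x.
move: s {sB}; elim=> [|x s [U FU Us]].
  by exists setT; [exact: filterT|rewrite set_nil bigcup_set0 setI0].
have [_ [_ [U' FU' Ux]]] := fP x.
exists (U `&` U'); first exact: filterI.
rewrite -subset0 => y [[Uy U'y] [z /=]].
rewrite inE => /orP[/eqP ->|zs] fzy.
  by have : (U' `&` f x) y by []; rewrite Ux.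
suff : (U `&` \bigcup_(x in [set` s]) f x) y by rewrite Us.
by split => //; exists z.
Qed.

Hypothesis hX : hausdorff_space X.

Lemma compact_separation A B : compact A -> compact B -> A `&` B = set0 ->
  exists U V, [/\ open U, open V, A `<=` U, B `<=` V & U `&` V = set0].
Proof.
move=> cA cB AB.
suff [V [U [oV AV BU UV]]] :
    exists V U, [/\ open V, A `<=` V, set_nbhs B U & U `&` V = set0].
  have /set_nbhsP [C [oC BC CU]] := BU.
  exists V, C; split => //; rewrite -subset0 => x [Vx Cx].
  suff : (U `&` V) x by rewrite UV.
  by split => //; exact: CU.
apply: compact_filter_separation => // a Aa.
have [V [U [oV BV aU UV]]] :
    exists V U, [/\ open V, B `<=` V, nbhs a U & U `&` V = set0].
  apply: compact_filter_separation => // b Bb.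
  move: (hX); rewrite open_hausdorff => /(_ a b)[].
    apply/eqP => ab; have : (A `&` B) a by split => //; rewrite ab.
    by rewrite AB.
  move=> [U V] /= [/set_mem Ua /set_mem Vb] [oU oV /eqP UV].
  by exists V, U; split => //; exact: open_nbhs_nbhs.
move: aU; rewrite nbhsE => -[W [oW Wa] WU].
exists W, V; split => //.
  by apply/set_nbhsP; exists V; split.
rewrite setIC -subset0 => x [Wx Vx].
suff : (U `&` V) x by rewrite UV.
by split => //; exact: WU.
Qed.

Lemma compactI_open_compl K U : compact K -> open U -> compact (K `\` U).
Proof.
by move=> cK oU; rewrite setDE; apply: compact_closedI => //; exact: open_closedC.
Qed.

(** The disjoint compact sets [K \ U] and [K \ V] have disjoint open neighbourhoods; removing one or
    the other from [K] leaves the two pieces. This is what makes inner contents subadditive on open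
    sets. *)
Lemma compact_split K U V : compact K -> open U -> open V -> K `<=` U `|` V ->
  exists K1 K2, [/\ compact K1, compact K2, K1 `<=` U, K2 `<=` V
    & K = K1 `|` K2].
Proof.
move=> cK oU oV KUV.
have [| | |W1 [W2 [oO1 oO2 KO1 KO2 W12]]] :=
    @compact_separation (K `\` U) (K `\` V).
- exact: compactI_open_compl.
- exact: compactI_open_compl.
- by rewrite -subset0 => x [[Kx nUx] [_ nVx]]; have [] := KUV _ Kx.
exists (K `\` W1), (K `\` W2); split.
- exact: compactI_open_compl.
- exact: compactI_open_compl.
- by move=> x [Kx nO]; apply: contrapT => nU; exact/nO/KO1.
- by move=> x [Kx nO]; apply: contrapT => nU; exact/nO/KO2.
- rewrite -setDIr W12 setD0 //.
Qed.

Lemma locally_compact_nbhs (x : X) : locally_compact [set: X] ->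
  exists2 K, compact K & nbhs x K.
Proof.
move=> /(_ x I) [K]; rewrite withinET => xK [cK _]; by exists K.
Qed.

Lemma compact_open_nbhd K : locally_compact [set: X] -> compact K ->
  exists U L, [/\ open U, compact L, K `<=` U & U `<=` L].
Proof.
move=> lX cK; have /choice [f fP] (x : X) : exists L : set X,
    compact L /\ nbhs x L.
  by have [L cL xL] := locally_compact_nbhs x lX; exists L.
have [s Ks] := @compact_seq_subcover K (fun x => (f x)°) cK
  (fun x _ => nbhs_interior (fP x).2).
exists (\bigcup_(x in [set` s]) (f x)°), (\bigcup_(x in [set` s]) f x).
split => //.
- by apply: bigcup_open => x _; exact: open_interior.
- move: s {Ks}; elim=> [|x s IH]; first by rewrite set_nil bigcup_set0;
  exact: compact0.
  have -> : [set` x :: s] = x |` [set` s].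
    by rewrite predeqE => y /=; rewrite inE; split=> /predU1P.
  by rewrite bigcup_setU1; apply: compactU => //; have [] := fP x.
- by apply: subset_bigcup => x _; exact: interior_subset.
Qed.

End compact_lemmas.

Lemma second_countable_seq_basis (X : topologicalType) : @second_countable X ->
  exists U : nat -> set X, (forall n, open (U n)) /\
    forall x A, nbhs x A -> exists n, U n x /\ U n `<=` A.
Proof.
move=> [B /countable_injP[e] eB [openB baseB]].
have /choice [U UP] (n : nat) : exists V : set X, open V /\
    forall W, B W -> e W = n -> W = V.
  have [[V [BV Vn]]|nV] := pselect (exists V, B V /\ e V = n).
    exists V; split; first exact: openB.
    by move=> W BW Wn; apply: eB; rewrite ?inE // Wn.
  exists set0; split; first exact: open0.
  by move=> W BW Wn; case: nV; exists W.
exists U; split=> [n|x A xA]; first by have [] := UP n.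
have [W [BW Wx] WA] := baseB x _ xA.
by exists (e W); have [_ /(_ W BW erefl) <-] := UP (e W).
Qed.

(** Lindelof argument: each basic open set contained in some [f z] selects one such [z]; all other
    indices get the arbitrary point [x0]. *)
Lemma second_countable_subcover (X : topologicalType) (x0 : X) (f : X -> set X) :
  @second_countable X -> (forall x, nbhs x (f x)) ->
  exists u : nat -> X, forall y, exists n, f (u n) y.
Proof.
move=> /second_countable_seq_basis[U [_ UP]] fx.
have /choice [u uP] (n : nat) : exists x, (exists z, U n `<=` f z) -> U n `<=` f x.
  have [[z Uz]|nU] := pselect (exists z, U n `<=` f z); first by exists z.
  by exists x0.
exists u => y; have [n [Uy Uf]] := UP _ _ (fx y).
by exists n; apply: uP Uy; exists y.
Qed.

(** * Radon measures from contents *)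

Section content.
Local Open Scope ereal_scope.
Variables (R : realType) (X : topologicalType).
Implicit Types (lam : set X -> \bar R) (K L U V S : set X).

Definition compact_content lam : Prop :=
  [/\ forall K, compact K -> 0 <= lam K < +oo,
      forall K L, compact K -> compact L -> K `<=` L -> lam K <= lam L,
      forall K L, compact K -> compact L -> lam (K `|` L) <= lam K + lam L &
      forall K L, compact K -> compact L -> K `&` L = set0 ->
        lam (K `|` L) = lam K + lam L].

Definition inner_content lam U :=
  ereal_sup [set lam K | K in [set K | compact K /\ K `<=` U]].

Definition outer_content lam S :=
  ereal_inf [set inner_content lam U | U in [set U | open U /\ S `<=` U]].

Variable lam : set X -> \bar R.
Hypothesis lamP : compact_content lam.

Let ic := inner_content lam.
Let oc := outer_content lam.

Lemma content0 : lam set0 = 0.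
Proof.
have [lam_fin _ _ lamD] := lamP.
have := lamD _ _ (@compact0 X) (@compact0 X) (setI0 _).
rewrite setU0; have /andP[] := lam_fin _ (@compact0 X).
by case: (lam set0) => //= r _ _ [] /eqP; rewrite -subr_eq subrr => /eqP <-.
Qed.

Lemma le_inner_content K U : compact K -> K `<=` U -> lam K <= ic U.
Proof. by move=> cK KU; apply: ereal_sup_ubound; exists K. Qed.

Lemma inner_content_ge0 U : 0 <= ic U.
Proof. by rewrite -content0; apply: le_inner_content => //; exact: compact0. Qed.

Lemma inner_content_le U V : U `<=` V -> ic U <= ic V.
Proof.
move=> UV; apply: ereal_sup_le => _ [K [cK KU] <-].
by exists K => //; split=> //; exact: subset_trans UV.
Qed.

Lemma outer_content_open U : open U -> oc U = ic U.
Proof.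
move=> oU; apply/eqP; rewrite eq_le; apply/andP; split.
  by apply: ereal_inf_lbound; exists U => //; split.
by apply: le_ereal_inf_tmp => _ [V [oV UV] <-]; exact: inner_content_le.
Qed.

Lemma outer_content_ge0 S : 0 <= oc S.
Proof. by apply: le_ereal_inf_tmp => _ [V _ <-]; exact: inner_content_ge0. Qed.

Lemma outer_content_le : {homo oc : S V / S `<=` V >-> S <= V}.
Proof.
move=> S V SV; apply: ereal_inf_le_tmp => _ [U [oU VU] <-].
by exists U => //; split=> //; exact: subset_trans VU.
Qed.

Lemma outer_content0 : oc set0 = 0.
Proof.
apply/eqP; rewrite eq_le outer_content_ge0 andbT outer_content_open //;
  last exact: open0.
by apply: ge_ereal_sup => x [K [_]]; rewrite subset0 => -> <-; rewrite content0.
Qed.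

Hypothesis hX : hausdorff_space X.

(** A compact subset of the union lies in a finite union, along which it is cut into compact pieces
    one open set at a time. *)
Lemma inner_content_bigcup (U : (set X)^nat) : (forall n, open (U n)) ->
  ic (\bigcup_n U n) <= \sum_(n <oo) ic (U n).
Proof.
have [_ _ lamU _] := lamP.
move=> oU; apply: ge_ereal_sup => _ [K [cK KU] <-].
have oUn n : open (\bigcup_(i < n) U i) by apply: bigcup_open.
have [n Kn] : exists n, K `<=` \bigcup_(i < n) U i.
  apply: compact_nondecreasing_cover => //.
    by move=> m n mn; apply/subsetPset => x [i im Uix]; exists i => //=;
      exact: leq_trans mn.
  by move=> x /KU [i _ Uix]; exists i.+1 => //; exists i => /=.
have {}lamU : forall n K, compact K -> K `<=` \bigcup_(i < n) U i ->
    lam K <= \sum_(0 <= i < n) ic (U i).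
  elim=> [|m IH] L cL.
    rewrite II0 bigcup_set0 subset0 => ->.
    by rewrite content0 big_nil.
  rewrite bigcup_mkord big_ord_recr /= -bigcup_mkord => LU.
  have [K1 [K2 [cK1 cK2 K1U K2U LE]]] := compact_split hX cL (oUn m) (oU m) LU.
  rewrite LE; apply: le_trans (lamU _ _ cK1 cK2) _.
  by rewrite big_nat_recr //=; apply: leeD; [exact: IH|exact: le_inner_content].
apply: le_trans (lamU _ _ cK Kn) _.
by apply: nneseries_lim_ge => i _ _; exact: inner_content_ge0.
Qed.

Lemma outer_content_sigma_subadditive : sigma_subadditive oc.
Proof.
move=> F; apply/lee_addgt0Pr => e e0.
have /choice [U UP] (n : nat) : exists U, [/\ open U, F n `<=` U &
    ic U <= oc (F n) + (e / (2 ^ n.+1)%:R)%:E].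
  have [fin|] := boolP (oc (F n) \is a fin_num).
    have en : (0 < e / (2 ^ n.+1)%:R)%R by rewrite divr_gt0 // ltr0n expn_gt0.
    have [_ [U [oU FU] <-] /ltW leU] := lb_ereal_inf_adherent en fin.
    by exists U.
  rewrite ge0_fin_numE ?outer_content_ge0 // ltey negbK => /eqP ->.
  by exists setT; split => //; [exact: openT|rewrite addye // leey].
apply: le_trans (epsilon_trick xpredT _ (ltW e0)); last first.
  by move=> n; exact: outer_content_ge0.
apply: (@le_trans _ _ (ic (\bigcup_n U n))).
  rewrite -outer_content_open; last by apply: bigcup_open => n _; have [] := UP n.
  by apply: outer_content_le; apply: subset_bigcup => n _; have [] := UP n.
apply: le_trans (inner_content_bigcup _) _; first by move=> n; have [] := UP n.
by apply: lee_nneseries => [n _ _|n _]; [exact: inner_content_ge0|have [] := UP n].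
Qed.

HB.instance Definition _ := isOuterMeasure.Build R X oc
  outer_content0 outer_content_ge0 outer_content_le outer_content_sigma_subadditive.

(** For an open [V] containing [S], take a compact [K] in the intersection of [V] and [U], then a
    compact [L] in [V \ K]. They are disjoint, so [lam K + lam L <= ic V]; the supremum over [L],
    then over [K], gives the Caratheodory inequality. *)
Lemma open_caratheodory U : open U -> oc.-caratheodory U.
Proof.
have [lam_fin _ _ lamD] := lamP.
move=> oU; apply: le_caratheodory_measurable => S.
apply: le_ereal_inf_tmp => _ [V [oV SV] <-]; rewrite -/(ic V).
apply: (@le_trans _ _ (ic (V `&` U) + oc (V `\` U))).
  apply: leeD; last by apply: outer_content_le; rewrite setDE; exact: setSI.
  by rewrite -outer_content_open; [apply: outer_content_le;
    exact: setSI|exact: openI].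
(* Past the trivial infinite case all terms are finite and may be moved across the inequality. *)
have [->|/eqP Vy] := pselect (ic V = +oo); first by rewrite leey.
have Vfin : ic V \is a fin_num.
  by rewrite ge0_fin_numE ?inner_content_ge0 // ltey.
have VUfin : oc (V `\` U) \is a fin_num.
  rewrite ge0_fin_numE ?outer_content_ge0 //.
  apply: (@le_lt_trans _ _ (ic V)); last by rewrite ltey.
  by rewrite -outer_content_open //; apply: outer_content_le => x [].
rewrite -leeBrDr //; apply: ge_ereal_sup => _ [K [cK KVU] <-].
have /andP[K0 Kfin] := lam_fin _ cK.
have {}Kfin : lam K \is a fin_num by rewrite ge0_fin_numE.
rewrite leeBrDr // addeC -leeBrDr //.
have oVK : open (V `\` K).
  by rewrite setDE; apply: openI => //; by apply: closed_openC;
    apply: compact_closed.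
apply: (@le_trans _ _ (ic (V `\` K))).
  rewrite -outer_content_open //; apply: outer_content_le => x [Vx nUx].
  by split => // /KVU [].
apply: ge_ereal_sup => _ [L [cL LVK] <-].
rewrite leeBrDr // addeC -lamD //.
  apply: le_inner_content; first exact: compactU.
  by move=> x [/KVU[]|/LVK[]].
by rewrite -subset0 => x [Kx /LVK[_]].
Qed.

End content.

Section content_measure.
Local Open Scope ring_scope.
Local Open Scope ereal_scope.
Variables (R : realType) (G : preTopologicalGroupType).
Hypotheses (hG : hausdorff_space G) (lG : locally_compact [set: G]).
Variable lam : set G -> \bar R.
Hypothesis lamP : compact_content lam.

Let oc : set (borel_group G) -> \bar R := outer_content lam.

HB.instance Definition _ := isOuterMeasure.Build R (borel_group G) oc
  (outer_content0 lamP) (outer_content_ge0 lamP) (@outer_content_le _ _ lam)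
  (outer_content_sigma_subadditive lamP hG).

Let borel_caratheodory (B : set (borel_group G)) :
  measurable B -> oc.-caratheodory B.
Proof.
suff : @borel G `<=` oc.-cara.-measurable by apply.
apply: smallest_sub; last by move=> U oU; exact: open_caratheodory.
split; first exact: measurable0.
- by move=> A mA; rewrite setTD; exact: measurableC.
- by move=> F mF; exact: bigcupT_measurable.
Qed.

Let oc_sigma_additive : semi_sigma_additive oc.
Proof.
move=> F mF tF mUF; apply: (@caratheodory_measure_sigma_additive _ _ oc) => //.
- by move=> i; exact: borel_caratheodory.
- exact: borel_caratheodory.
Qed.

HB.instance Definition _ := isMeasure.Build _ _ R oc
  (outer_content0 lamP) (outer_content_ge0 lamP) oc_sigma_additive.

Let oc_open (U : set G) : open U -> oc U = inner_content lam U.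
Proof. exact: outer_content_open. Qed.

Let le_content_outer (K : set G) : compact K -> lam K <= oc K.
Proof.
move=> cK; apply: le_ereal_inf_tmp => _ [U [oU KU] <-].
exact: le_inner_content.
Qed.

(** On compact sets the measure is only claimed to dominate the content, since equality would
    require a regular content. The inequality serves to show that the measure is nonzero. *)
Lemma content_radon_measure :
  exists mu : {measure set (borel_group G) -> \bar R},
    [/\ radon_measure mu, forall S, mu S = outer_content lam S
      & forall K : set G, compact K -> lam K <= mu K].
Proof.
have [lam_fin lam_le _ _] := lamP.
exists oc; split => //; split.
- move=> K cK; have [U [L [oU cL KU UL]]] := compact_open_nbhd lG cK.
  apply: (@le_lt_trans _ _ (oc U)); first exact: outer_content_le.
  rewrite oc_open //.
  apply: (@le_lt_trans _ _ (lam L)); last by have /andP[] := lam_fin _ cL.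
  apply: ge_ereal_sup => _ [K' [cK' K'U] <-]; apply: lam_le => //.
  exact: subset_trans UL.
- move=> B _; congr ereal_inf; apply: eq_imagel => U [oU _].
  exact/esym/oc_open.
- move=> U oU; transitivity (inner_content lam U); first exact: oc_open.
  apply/eqP; rewrite eq_le; apply/andP; split.
    apply: ge_ereal_sup => _ [K [cK KU] <-]; apply: le_ereal_sup_tmp.
    by exists (oc K); [exists K|exact: le_content_outer].
  apply: ge_ereal_sup => _ [K [cK KU] <-].
  by rewrite -(outer_content_open lam oU); exact: outer_content_le.
Qed.

End content_measure.

(** * Contents scaled by a homeomorphism *)

Section outer_content_image.
Local Open Scope ring_scope.
Local Open Scope ereal_scope.
Variables (R : realType) (X : topologicalType) (lam : set X -> \bar R).
Variables (f g : X -> X) (c : R).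
Hypotheses (fK : cancel f g) (gK : cancel g f).
Hypotheses (cf : continuous f) (cg : continuous g) (c0 : (0 < c)%R).
Hypothesis lamf : forall K, compact K -> lam (f @` K) = c%:E * lam K.

Let imageE (h k : X -> X) : cancel h k -> cancel k h ->
  forall S, h @` S = k @^-1` S.
Proof.
move=> hK kK S; rewrite predeqE => x; split=> [[y Sy <-]|Skx] /=.
  by rewrite hK.
by exists (k x).
Qed.

Let cptf (h : X -> X) K : continuous h -> compact K -> compact (h @` K).
Proof.
by move=> ch; apply: continuous_compact; exact: continuous_subspaceT.
Qed.

Let inner_content_image U :
  inner_content lam (f @` U) = c%:E * inner_content lam U.
Proof.
rewrite /inner_content -ereal_sup_pZl //; congr ereal_sup.
rewrite predeqE => x; split=> [[K [cK KfU] <-]|[_ [K [cK KU] <-] <-]].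
  exists (lam (g @` K)).
    exists (g @` K) => //; split; first exact: cptf.
    by move=> _ [y /KfU [z Uz <-] <-]; rewrite fK.
  rewrite -lamf; last exact: cptf.
  congr lam; rewrite image_comp eq_image_id //.
  by move=> y _ /=; exact: gK.
exists (f @` K); last by rewrite lamf.
by split; [exact: cptf|exact: image_subset].
Qed.

(** A homeomorphism permutes the compact sets and the open sets, so a scaling of the content passes
    to the supremum over compact sets and then to the infimum over open sets. It is used with
    [c = 1] for left translations and with a modular factor for right ones. *)
Lemma outer_content_image S :
  outer_content lam (f @` S) = c%:E * outer_content lam S.
Proof.
rewrite /outer_content -ereal_inf_pZl //; congr ereal_inf.
rewrite predeqE => x; split=> [[U [oU fSU] <-]|[_ [U [oU SU] <-] <-]].
  exists (inner_content lam (g @` U)).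
    exists (g @` U) => //; split.
      by rewrite (imageE gK fK); apply: open_comp.
    by move=> y Sy; exists (f y); [apply: fSU; exists y|exact: fK].
  rewrite -inner_content_image.
  congr inner_content; rewrite image_comp eq_image_id //.
  by move=> y _ /=; exact: gK.
exists (f @` U); last by rewrite inner_content_image.
split; last exact: image_subset.
by rewrite (imageE fK gK); apply: open_comp.
Qed.

End outer_content_image.

(** * Existence of Haar measures *)

Section topological_group_lemmas.
Local Open Scope group_scope.
Variable G : preTopologicalGroupType.
Hypothesis tG : topological_group G.

Lemma mulg_cvg (T : Type) (F : set_system T) (f g : T -> G) (a b : G) :
  Filter F -> f @ F --> a -> g @ F --> b -> (f x * g x) @[x --> F] --> a * b.
Proof.
move=> FF fa gb; have [cM _] := tG.
by apply: continuous2_cvg fa gb; exact: (cM (a, b)).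
Qed.

Lemma invg_cvg (T : Type) (F : set_system T) (f : T -> G) (a : G) :
  Filter F -> f @ F --> a -> (f x)^-1 @[x --> F] --> a^-1.
Proof. by move=> FF fa; have [_ cV] := tG; exact: continuous_cvg (cV a) fa. Qed.

Lemma mulgl_continuous (s : G) : continuous (fun x : G => s * x).
Proof. by move=> x; apply: mulg_cvg; [exact: cvg_cst|exact: cvg_id]. Qed.

Lemma mulgr_continuous (s : G) : continuous (fun x : G => x * s).
Proof. by move=> x; apply: mulg_cvg; [exact: cvg_id|exact: cvg_cst]. Qed.

Lemma nbhs_mulgl (s : G) (V : set G) : nbhs 1 V ->
  nbhs s [set x | V (s^-1 * x)].
Proof.
by move=> V1; apply: (mulgl_continuous (s := s^-1)); rewrite /= mulVg.
Qed.

Lemma compact_mulgl (s : G) (K : set G) : compact K ->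
  compact [set s * x | x in K].
Proof.
apply: continuous_compact; apply: continuous_subspaceT.
exact: mulgl_continuous.
Qed.

Lemma compact_mulgr (s : G) (K : set G) : compact K ->
  compact [set x * s | x in K].
Proof.
apply: continuous_compact; apply: continuous_subspaceT.
exact: mulgr_continuous.
Qed.

Lemma image_mulgl (s : G) (B : set G) :
  [set s * x | x in B] = [set x | B (s^-1 * x)].
Proof.
rewrite predeqE => x; split=> [[y By <-]|Bx] /=; first by rewrite mulKg.
by exists (s^-1 * x) => //; rewrite mulVKg.
Qed.

Lemma image_mulgr (s : G) (B : set G) :
  [set x * s | x in B] = [set x | B (x * s^-1)].
Proof.
rewrite predeqE => x; split=> [[y By <-]|Bx] /=; first by rewrite mulgK.
by exists (x * s^-1) => //; rewrite mulgVK.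
Qed.

Lemma borel_preimage (X Y : topologicalType) (f : X -> Y) :
  continuous f -> borel_fun f.
Proof.
move=> cf B mB; pose C := [set B | @borel X (f @^-1` B)].
suff : @borel Y `<=` C by apply.
apply: smallest_sub; last first.
  by move=> U oU; apply: sub_sigma_algebra; move/continuousP: cf; apply.
split; rewrite /C /=.
- by rewrite preimage_set0; exact: sigma_algebra0.
- move=> U mU; rewrite setTD preimage_setC -setTD; exact: sigma_algebraCD.
- move=> F mF; rewrite preimage_bigcup; exact: sigma_algebra_bigcup.
Qed.

Lemma open_borel (X : topologicalType) (U : set X) : open U -> borel U.
Proof. exact: sub_sigma_algebra. Qed.

Lemma compact_borel (X : topologicalType) (K : set X) :
  hausdorff_space X -> compact K -> borel K.
Proof.
move=> hX cK; rewrite -[K]setCK -setTD; apply: sigma_algebraCD.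
by apply: open_borel; apply: closed_openC; exact: compact_closed.
Qed.

Lemma borel_mulgl (s : G) (B : set G) : borel B -> borel [set s * x | x in B].
Proof.
by move=> mB; rewrite image_mulgl; apply: (borel_preimage (@mulgl_continuous _)).
Qed.

Lemma borel_mulgr (s : G) (B : set G) : borel B -> borel [set x * s | x in B].
Proof.
by move=> mB; rewrite image_mulgr; apply: (borel_preimage (@mulgr_continuous _)).
Qed.

End topological_group_lemmas.

(** * Covering numbers by translates *)

Section haar_covering.
Local Open Scope group_scope.
Variable G : preTopologicalGroupType.
Hypothesis tG : topological_group G.
Implicit Types (K L V : set G) (s : seq G).

(* [V (x^-1 * y)] says that [y] lies in the translate [x V]. *)
Definition translates_cover V K s :=
  forall y, K y -> exists2 x, x \in s & V (x^-1 * y).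

Lemma translates_cover_compact V K : nbhs 1 V -> compact K ->
  exists s, translates_cover V K s.
Proof.
move=> V1 cK; have [s sK] := compact_seq_subcover cK
  (fun x _ => nbhs_mulgl tG x V1).
by exists s => y /sK [x xs Vxy]; exists x.
Qed.

Let has_cover_of_size V K n :=
  `[< exists2 s, size s = n & translates_cover V K s >].

(* Junk value [0] when no finite family of translates of [V] covers [K]. *)
Definition covering_number V K : nat :=
  if pselect (exists n, has_cover_of_size V K n) is left exP
  then ex_minn exP else 0.

Lemma covering_number_le V K s :
  translates_cover V K s -> (covering_number V K <= size s)%N.
Proof.
move=> sK; rewrite /covering_number; case: pselect => // exP.
by case: ex_minnP => n _; apply; apply/asboolP; exists s.
Qed.

Lemma covering_number_witness V K : nbhs 1 V -> compact K ->
  exists2 s, size s = covering_number V K & translates_cover V K s.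
Proof.
move=> V1 cK; rewrite /covering_number; case: pselect => [exP|].
  by case: ex_minnP => n /asboolP.
have [s sK] := translates_cover_compact V1 cK.
by case; exists (size s); apply/asboolP; exists s.
Qed.

Lemma covering_number_mono V K L : nbhs 1 V -> compact L -> K `<=` L ->
  (covering_number V K <= covering_number V L)%N.
Proof.
move=> V1 cL KL; have [s <- sL] := covering_number_witness V1 cL.
by apply: covering_number_le => y /KL /sL.
Qed.

Lemma covering_numberU V K L : nbhs 1 V -> compact K -> compact L ->
  (covering_number V (K `|` L) <= covering_number V K + covering_number V L)%N.
Proof.
move=> V1 cK cL; have [s <- sK] := covering_number_witness V1 cK.
have [t <- tL] := covering_number_witness V1 cL.
rewrite -size_cat; apply: covering_number_le.
by move=> y [/sK|/tL] [x xs Vxy]; exists x; rewrite // mem_cat xs ?orbT.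
Qed.

(** Translates [x L] that cover [K] and translates [z V] that cover [L] combine into translates
    [x z V] that cover [K]. This bounds the ratio of the covering numbers of [K] and [L]
    independently of [V]. *)
Lemma covering_number_mul V K L : nbhs 1 V -> nbhs 1 L -> compact K ->
  compact L ->
  (covering_number V K <= covering_number L K * covering_number V L)%N.
Proof.
move=> V1 L1 cK cL; have [s <- sK] := covering_number_witness L1 cK.
have [t <- tL] := covering_number_witness V1 cL.
rewrite -(size_allpairs (fun x y : G => x * y));
  apply: covering_number_le => y /sK [x xs].
move=> /tL [z zt Vzxy]; exists (x * z); first by apply/allpairsP; exists (x, z).
by rewrite invgM -mulgA.
Qed.

Lemma covering_number_gt0 V K : nbhs 1 V -> compact K -> K !=set0 ->
  (0 < covering_number V K)%N.
Proof.
move=> V1 cK [y Ky]; have [s <- sK] := covering_number_witness V1 cK.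
by have [x + _] := sK _ Ky; case: s {sK}.
Qed.

Lemma covering_number_mulgl V K a : nbhs 1 V -> compact K ->
  covering_number V [set a * x | x in K] = covering_number V K.
Proof.
move=> V1; suff le b L : compact L ->
    (covering_number V [set (b * x)%g | x in L] <= covering_number V L)%N.
  move=> cK; apply/eqP; rewrite eqn_leq le //=.
  have -> : K = [set (a^-1 * x)%g | x in [set (a * x)%g | x in K]].
    by rewrite image_comp eq_image_id // => x _ /=; rewrite mulKg.
  have -> : [set (a * x)%g | x in [set a^-1 * x | x in [set a * x | x in K]]] =
      [set (a * x)%g | x in K].
    by rewrite image_comp eq_image_id // => x _ /=; rewrite mulVKg.
  by apply: le; exact: compact_mulgl.
move=> cL; have [s <- sL] := covering_number_witness V1 cL.
rewrite -(size_map (fun x => b * x));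
  apply: covering_number_le => _ [y /sL[x xs Vxy] <-].
by exists (b * x); [exact: map_f|rewrite invgM -mulgA mulKg].
Qed.

(** No translate of [V] meets both sets, so an optimal cover of the union splits into the translates
    that meet [K], which cover [K], and the others, which cover [L]. *)
Lemma covering_numberU_ge V K L : nbhs 1 V -> compact K -> compact L ->
  (forall x k l, K k -> L l -> V (x^-1 * k) -> ~ V (x^-1 * l)) ->
  (covering_number V K + covering_number V L <= covering_number V (K `|` L))%N.
Proof.
move=> V1 cK cL VKL.
have [s <- sKL] := covering_number_witness V1 (compactU cK cL).
pose p x := `[< exists2 k, K k & V (x^-1 * k) >].
rewrite -(count_predC p) -!size_filter; apply: leq_add.
  apply: covering_number_le => k Kk; have [|x xs Vxk] := sKL k; first by left.
  by exists x => //; rewrite mem_filter xs andbT; apply/asboolP; exists k.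
apply: covering_number_le => l Ll; have [|x xs Vxl] := sKL l; first by right.
exists x => //; rewrite mem_filter xs andbT /=; apply/asboolP => -[k Kk Vxk].
exact: (VKL _ _ _ Kk Ll Vxk Vxl).
Qed.

(** The compact set [C = L^-1 K] misses [1]. If [x V] contained [k] and [l], then
    [l^-1 k = (x^-1 l)^-1 (x^-1 k)] would lie in [V^-1 V], which avoids [C] for small [V]. *)
Lemma disjoint_compact_translates K L : hausdorff_space G ->
  compact K -> compact L -> K `&` L = set0 ->
  exists2 W : set G, nbhs 1 W & forall V, V `<=` W ->
    forall x k l, K k -> L l -> V (x^-1 * k) -> ~ V (x^-1 * l).
Proof.
move=> hG cK cL KL0.
pose C := [set u.1^-1 * u.2 | u in L `*` K].
have cC : compact C.
  apply: continuous_compact; last exact: compact_setX.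
  apply: continuous_subspaceT => u; apply: (mulg_cvg tG).
    by apply: (invg_cvg tG); exact: cvg_fst.
  exact: cvg_snd.
have C1 : nbhs (1^-1 * 1 : G) (~` C).
  apply: open_nbhs_nbhs; split.
    by apply: closed_openC; apply: compact_closed.
  rewrite mulVg => -[[l k] /= [Ll Kk]] /mulg1_eq; rewrite invgK => lk.
  have : (K `&` L) k by split => //; rewrite -lk.
  by rewrite KL0.
have /(_ _ C1) [[W1 W2] /= [W11 W21] W12] :
    (fun u : G * G => u.1^-1 * u.2) @ (1, 1) --> (1^-1 * 1 : G).
  apply: (mulg_cvg tG); last exact: cvg_snd.
  by apply: (invg_cvg tG); exact: cvg_fst.
exists (W1 `&` W2); first exact: filterI.
move=> V VW x k l Kk Ll /VW[_ W2k] /VW[W1l _].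
apply: (W12 (x^-1 * l, x^-1 * k)) => //; exists (l, k) => //=.
by rewrite invgM invgK -mulgA mulVKg.
Qed.

End haar_covering.

(** * Limits along ultrafilters *)

Section ultrafilter_limit.

Lemma ultra_fmap (T U : Type) (f : T -> U) (F : set_system T) :
  UltraFilter F -> UltraFilter (f @ F).
Proof.
move=> UF; have PF : ProperFilter F by exact: ultra_proper.
apply: Build_UltraFilter => H PH FH; rewrite eqEsubset; split => // B HB.
have [//|FB] := in_ultra_setVsetC (f @^-1` B) UF.
have /(filterI HB) : H (~` B) by exact: FH.
by rewrite setICr => H0; have [] := @filter_not_empty _ _ PH.
Qed.

(** The image of an ultrafilter is an ultrafilter, and one that contains a compact segment
    converges. This stands in for the usual Tychonoff argument in the construction of Haar
    measures. *)
Lemma ultra_cvg_bounded (R : realType) (T : Type) (F : set_system T)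
    (f : T -> R) (a b : R) : UltraFilter F ->
  (\forall x \near F, a <= f x <= b)%R -> cvg (f @ F).
Proof.
move=> UF ab; have := @segment_compact R a b; rewrite compact_ultra.
move=> /(_ (f @ F) (ultra_fmap _ UF)) [|l [_ fl]]; last by apply/cvg_ex; exists l.
by rewrite /= nbhs_filterE; apply: filterS ab => x; rewrite /= in_itv.
Qed.

End ultrafilter_limit.

(** * Construction of a Haar measure *)

Section haar_existence.
Local Open Scope ring_scope.
Variables (R : realType) (G : preTopologicalGroupType).
Hypothesis lcG : locally_compact_group G.

Theorem haar_measure_exists :
  exists mu : {measure set (borel_group G) -> \bar R}, left_haar_measure mu.
Proof.
have [tG hG lG] := lcG.
have [K0 cK0 K01] := locally_compact_nbhs (1%g : G) lG.
(* [U] refines the filter of small neighbourhoods of [1]: by [nearU], whatever holds for all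
   neighbourhoods of [1] inside a fixed one holds along [U]. *)
have [U [UU sU]] := ultraFilterLemma 
  (powerset_filter_from_filter (nbhs_pfilter (1%g : G))).
have PU : ProperFilter U by exact: ultra_proper.
have nearU (P : set G -> Prop) W : nbhs 1%g W ->
    (forall V, nbhs 1%g V -> V `<=` W -> P V) -> \forall V \near U, P V.
  move=> W1 WP; apply: sU.
  near=> V; apply: WP; first exact: (near (near_small_set _)).
  exact: (near (small_set_sub W1)).
have K0_neq0 : K0 !=set0 by exists 1%g; exact: nbhs_singleton.
(* Haar's ratio, normalized by the fixed compact neighbourhood [K0]; its limit as [V] shrinks is the
   content. *)
pose h K V : R := (covering_number V K)%:R / (covering_number V K0)%:R.
have h_cvg K : compact K -> cvg (h K @ U).
  move=> cK; apply: (@ultra_cvg_bounded _ _ U _ 0 (covering_number K0 K)%:R).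
  apply: (nearU _ setT) => [|V V1 _]; first exact: filterT.
  have K0_gt0 := covering_number_gt0 tG V1 cK0 K0_neq0.
  rewrite divr_ge0 ?ler0n //= ler_pdivrMr ?ltr0n //.
  by rewrite -natrM ler_nat; exact: covering_number_mul.
pose l K := lim (h K @ U).
have hl K : compact K -> h K @ U --> l K by move=> /h_cvg.
have l_le (x y : R) (f g : set G -> R) : f @ U --> x -> g @ U --> y ->
    (\forall V \near U, f V <= g V) -> x <= y.
  move=> fx gy fg; rewrite -subr_ge0.
  have fgxy : (fun V => g V - f V) @ U --> y - x by exact: cvgB.
  rewrite -(cvg_lim (@Rhausdorff R) fgxy); apply: limr_ge.
    by apply/cvg_ex; exists (y - x).
  by apply: filterS fg => V; rewrite -subr_ge0.
have nearT P : (forall V, nbhs 1%g V -> P V) -> \forall V \near U, P V.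
  by move=> VP; apply: (nearU _ setT) => [|V V1 _]; [exact: filterT|exact: VP].
pose lam K : \bar R := (l K)%:E.
have hU K L V : compact K -> compact L -> nbhs 1%g V ->
    h (K `|` L) V <= h K V + h L V.
  move=> cK cL V1; rewrite /h -mulrDl ler_wpM2r ?invr_ge0 ?ler0n //.
  by rewrite -natrD ler_nat; exact: covering_numberU.
have lamP : compact_content lam.
  split.
  - move=> K cK; rewrite ltry andbT lee_fin.
    apply: (l_le _ _ (cst 0) _ (cvg_cst _) (hl _ cK)).
    by apply: nearT => V V1; rewrite divr_ge0 ?ler0n.
  - move=> K L cK cL KL; rewrite lee_fin.
    apply: (l_le _ _ _ _ (hl _ cK) (hl _ cL)).
    apply: nearT => V V1; rewrite ler_wpM2r ?invr_ge0 ?ler0n // ler_nat.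
    exact: covering_number_mono.
  - move=> K L cK cL; rewrite lee_fin.
    apply: (l_le _ _ _ _ (hl _ (compactU cK cL)) (cvgD (hl _ cK) (hl _ cL))).
    by apply: nearT => V V1; exact: hU.
  - move=> K L cK cL KL0; rewrite -EFinD; congr (_%:E).
    apply/eqP; rewrite eq_le; apply/andP; split.
      apply: (l_le _ _ _ _ (hl _ (compactU cK cL)) (cvgD (hl _ cK) (hl _ cL))).
      by apply: nearT => V V1; exact: hU.
    apply: (l_le _ _ _ _ (cvgD (hl _ cK) (hl _ cL)) (hl _ (compactU cK cL))).
    (* As soon as [V] lies in [W], the ratios are superadditive on [K] and [L], so the limit is
       additive although the ratios are only subadditive in general. *)
    have [W W1 WP] := disjoint_compact_translates tG hG cK cL KL0.
    apply: (nearU _ W) => // V V1 VW.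
    suff : h K V + h L V <= h (K `|` L) V by [].
    rewrite /h -mulrDl ler_wpM2r ?invr_ge0 ?ler0n //.
    by rewrite -natrD ler_nat; apply: covering_numberU_ge => //; exact: WP.
have [mu [mu_radon muE lam_mu]] := content_radon_measure hG lG lamP.
exists mu; split => //.
- move=> s B mB; rewrite !muE.
  rewrite (@outer_content_image R G lam _ (fun x => (s^-1 * x)%g) 1) ?mul1e //.
  + by move=> x; rewrite mulKg.
  + by move=> x; rewrite mulVKg.
  + exact: mulgl_continuous.
  + exact: mulgl_continuous.
  + move=> K cK; rewrite mul1e; congr (_%:E).
    apply/eqP; rewrite eq_le; apply/andP; split.
      apply: (l_le _ _ _ _ (hl _ (compact_mulgl tG (s := s) cK)) (hl _ cK)).
      by apply: nearT => V V1; rewrite /h covering_number_mulgl.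
    apply: (l_le _ _ _ _ (hl _ cK) (hl _ (compact_mulgl tG (s := s) cK))).
    by apply: nearT => V V1; rewrite /h covering_number_mulgl.
(* The normalization makes [h K0] constantly [1], which forces the measure to be nonzero. *)
- have : (1 <= mu K0)%E.
    apply: le_trans (lam_mu _ cK0); rewrite lee_fin.
    apply: (l_le _ _ (cst 1) _ (cvg_cst _) (hl _ cK0)).
    apply: nearT => V V1; rewrite /h divff // pnatr_eq0 -lt0n.
    exact: covering_number_gt0.
  move=> mu1; rewrite gt_eqF //; apply: (@lt_le_trans _ _ 1%E) => //.
  apply: le_trans mu1 _; apply: le_measure => //; rewrite inE.
    exact: compact_borel.
  exact: measurableT.
Unshelve. all: by end_near. Qed.

End haar_existence.

(** * Steinhaus theorem *)

Section haar_facts.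
Local Open Scope ring_scope.
Local Open Scope ereal_scope.
Variables (R : realType) (G : preTopologicalGroupType).
Hypothesis lcG : locally_compact_group G.
Variable mu : {measure set (borel_group G) -> \bar R}.

Let tG : topological_group G. Proof. by case: lcG. Qed.
Let hG : hausdorff_space G. Proof. by case: lcG. Qed.
Let lG : locally_compact [set: G]. Proof. by case: lcG. Qed.

Lemma borel_measure_le (A B : set G) : borel A -> borel B -> A `<=` B ->
  mu A <= mu B.
Proof. exact: (fun mA mB => le_measure mu (mem_set mA) (mem_set mB)). Qed.

Lemma borel_measureU (A B : set G) : borel A -> borel B -> A `&` B = set0 ->
  mu (A `|` B) = mu A + mu B.
Proof. exact: (@measureU _ _ (borel_group G) mu). Qed.

Lemma borel_measureU0 (A B : set G) : borel A -> borel B ->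
  mu A = 0 -> mu B = 0 -> mu (A `|` B) = 0.
Proof.
move=> mA mB A0 B0; apply/eqP; rewrite eq_le measure_ge0 andbT.
have : mu (A `|` B) <= mu A + mu B := measureU2 mu mA mB.
by rewrite A0 B0 adde0.
Qed.

Hypothesis muH : left_haar_measure mu.

Let mu_compact (K : set G) : compact K -> mu K < +oo.
Proof. by case: muH => -[fin _ _] _ _; exact: fin. Qed.

Lemma haar_mulgl (s : G) (B : set G) : borel B ->
  mu [set x | B (s^-1 * x)%g] = mu B.
Proof. by move=> mB; rewrite -image_mulgl; case: muH => _ inv _; exact: inv. Qed.

(** Finitely many translates of a nonempty open set cover any given compact set. If [U] were null,
    all compact sets would be null, and inner regularity would make the whole group null. *)
Lemma haar_open_gt0 (U : set G) : open U -> U !=set0 -> 0 < mu U.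
Proof.
have [[_ _ inner_reg] _ mu_neq0] := muH.
move=> oU [x Ux]; rewrite lt0e measure_ge0 andbT.
apply/negP => /eqP mu0; move/negP: mu_neq0; apply; apply/eqP.
rewrite (inner_reg _ openT); apply/eqP; rewrite eq_le; apply/andP; split;
  last first.
  apply: ereal_sup_ubound; exists set0; last exact: measure0.
  by split; [exact: compact0|].
apply: ge_ereal_sup => _ [K [cK _] <-].
(* The translate of [U] by [y x^-1], which sends the point [x] of [U] to [y]. *)
pose V y : set G := [set z | U ((y * x^-1)^-1 * z)%g].
have oV y : open (V y).
  by have /continuousP := mulgl_continuous tG (s := (y * x^-1)^-1%g); apply.
have mV y : borel (V y) by exact: open_borel.
have Vy y : nbhs y (V y).
  by apply: open_nbhs_nbhs; split => //; rewrite /V /= invgM invgK mulgVK.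
have [s Ks] := compact_seq_subcover cK (fun y _ => Vy y).
have [ms s0] : borel (\bigcup_(y in [set` s]) V y) /\
    mu (\bigcup_(y in [set` s]) V y) = 0.
  move: s {Ks}; elim=> [|y s [ms s0]].
    by rewrite set_nil bigcup_set0 measure0; split => //; exact: sigma_algebra0.
  have -> : [set` y :: s] = y |` [set` s].
    by rewrite predeqE => z /=; rewrite inE; split=> /predU1P.
  rewrite bigcup_setU1; split.
    by apply: (@measurableU _ (borel_group G)) => //; exact: mV.
  by apply: borel_measureU0 => //; rewrite haar_mulgl ?mu0 //; exact: open_borel.
by rewrite -s0; apply: borel_measure_le => //; exact: compact_borel.
Qed.

Lemma haar_compact_nbhd : exists C : set G,
  [/\ compact C, nbhs 1%g C, borel C & 0 < mu C < +oo].
Proof.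
have [C cC C1] := locally_compact_nbhs (1%g : G) lG.
exists C; split => //; first exact: compact_borel.
rewrite mu_compact // andbT; apply: (@lt_le_trans _ _ (mu C°)).
  by apply: haar_open_gt0; [exact: open_interior|exists 1%g].
apply: borel_measure_le; last exact: interior_subset.
  by apply: open_borel; exact: open_interior.
exact: compact_borel.
Qed.

Lemma compact_mulg_nbhs (K V : set G) : compact K -> open V -> K `<=` V ->
  \forall w \near (1%g : G), forall k, K k -> V (w * k)%g.
Proof.
move=> /compact_near_coveringP cK oV KV.
apply: (cK G (nbhs (1%g : G)) (fun w k => V (w * k)%g)) => k Kk.
have V1k : nbhs (1 * k)%g V.
  by apply: open_nbhs_nbhs; split => //; rewrite mul1g; exact: KV.
have /(_ _ V1k) : (fun u : G * G => (u.2 * u.1)%g) @ (k, 1%g) --> (1 * k)%g.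
  by apply: (mulg_cvg tG); [exact: cvg_snd|exact: cvg_fst].
by [].
Qed.

End haar_facts.

Section steinhaus.
Local Open Scope ring_scope.
Local Open Scope ereal_scope.
Variables (R : realType) (G : preTopologicalGroupType).
Hypotheses (lcG : locally_compact_group G) (scG : @second_countable G).
Variable mu : {measure set (borel_group G) -> \bar R}.
Hypothesis muH : left_haar_measure mu.

Lemma sigma_compact_group : exists K : nat -> set G,
  (forall n, compact (K n)) /\ forall x, exists n, K n x.
Proof.
have [_ _ lG] := lcG; have /choice [f fP] (x : G) : exists K : set G,
  compact K /\ nbhs x K.
  by have [K cK xK] := locally_compact_nbhs x lG; exists K.
have [u uP] := second_countable_subcover (1%g : G) scG (fun x => (fP x).2).
by exists (f \o u); split => // n; have [] := fP (u n).
Qed.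

Lemma borel_bigcup_gt0 (F : nat -> set G) : (forall n, borel (F n)) ->
  0 < mu (\bigcup_n F n) -> exists n, 0 < mu (F n).
Proof.
move=> mF; apply: contraPP => /forallNP F0; apply/negP; rewrite -leNgt.
have F0' n : mu (F n) = 0.
  by apply/eqP; rewrite eq_le measure_ge0 andbT leNgt; apply/negP.
have mUF : borel (\bigcup_n F n) := @bigcupT_measurable _ (borel_group G) F mF.
apply: le_trans (measure_sigma_subadditive mu mF mUF (@subset_refl _ _)) _.
by rewrite eseries0 // => n _ _; rewrite F0'.
Qed.

(** Inner regularity is given on open sets only, so outer regularity is applied to [L \ B]: as
    [mu (L \ B) < mu L], some open [V] contains [L \ B] with [mu V < mu L], and [L \ V] is the
    required compact set. *)
Lemma borel_inner_compact (B L : set G) : borel B -> compact L -> B `<=` L ->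
  0 < mu B -> exists2 K, compact K /\ K `<=` B & 0 < mu K.
Proof.
have [[mu_fin outer_reg _] _ _] := muH; have [_ hG _] := lcG.
move=> mB cL BL B0; have mL := compact_borel hG cL.
have mLB : borel (L `\` B) by apply: (@measurableD _ (borel_group G)).
have LE : mu L = mu B + mu (L `\` B).
  rewrite -borel_measureU //; last by rewrite -subset0 => x [Bx []].
  congr (mu _); rewrite predeqE => x; split=> [Lx|[/BL //|[]//]].
  by have [Bx|nBx] := pselect (B x); [left|right].
have Lfin : mu L \is a fin_num by rewrite ge0_fin_numE ?measure_ge0 ?mu_fin.
have LBfin : mu (L `\` B) \is a fin_num.
  rewrite ge0_fin_numE ?measure_ge0 //; apply: le_lt_trans (mu_fin _ cL).
  exact: borel_measure_le.
have : mu (L `\` B) < mu L.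
  by rewrite LE addeC lteDl.
rewrite outer_reg // => /ereal_inf_lt [_ [V [oV LBV] <-] VL].
have mLV : borel (L `\` V) by apply: (@measurableD _ (borel_group G)) => //;
  exact: open_borel.
exists (L `\` V).
  split; first exact: compactI_open_compl.
  by move=> x [Lx nVx]; apply: contrapT => nB; exact/nVx/LBV.
rewrite lt0e measure_ge0 andbT; apply/negP => /eqP LV0.
have : mu L <= mu (L `\` V) + mu V.
  apply: le_trans (measureU2 mu mLV (open_borel oV)).
  apply: borel_measure_le => //.
    by apply: (@measurableU _ (borel_group G)) => //; exact: open_borel.
  by move=> x Lx; have [Vx|nVx] := pselect (V x); [right|left].
by rewrite LV0 add0e leNgt VL.
Qed.

(* Steinhaus: a compact subset [K] of [H] of positive measure meets all of its
   small translates, so that [K K^-1], hence [H], is a neighbourhood of [1]. *)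
Lemma borel_subgroup_open (H : set G) (u : nat -> G) : borel H ->
  (forall x y, H x -> H y -> H (x^-1 * y)%g) ->
  (forall x y, H x -> H y -> H (x * y)%g) ->
  (forall x, exists n, H ((u n)^-1 * x)%g) -> open H.
Proof.
have [tG hG _] := lcG; have [[mu_fin outer_reg _] _ _] := muH.
move=> mH HV HM Hu.
have H1 : H 1%g by have [n Hn] := Hu 1%g; rewrite -(mulVg ((u n)^-1 * 1)%g);
  exact: HV.
have mHu n : borel [set x | H ((u n)^-1 * x)%g] by rewrite -image_mulgl;
  exact: borel_mulgl.
(* Countably many translates of [H] cover the group, so one of them, hence [H] itself, has positive
   measure. *)
have [n] : exists n, 0 < mu [set x | H ((u n)^-1 * x)%g].
  apply: borel_bigcup_gt0 => //.
  rewrite (_ : \bigcup_n _ = setT); last by rewrite -subTset => x _;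
    have [n ?] := Hu x; exists n.
  by apply: haar_open_gt0 => //; [exact: openT|exists 1%g].
rewrite haar_mulgl // => muH_gt0.
have [L [cL LP]] := sigma_compact_group.
have mHL m : borel (H `&` L m).
  by apply: (@measurableI _ (borel_group G)) => //; exact: compact_borel.
have [m HLm] : exists m, 0 < mu (H `&` L m).
  apply: borel_bigcup_gt0 => //; rewrite -setI_bigcupr.
  rewrite (_ : \bigcup_m _ = setT) ?setIT //.
  by rewrite -subTset => x _; have [k ?] := LP x; exists k.
have [K [cK KHL] K0] := borel_inner_compact (mHL m) (cL m) (@subIsetr _ _ _) HLm.
have mK := compact_borel hG cK.
have Kfin : mu K \is a fin_num by rewrite ge0_fin_numE ?measure_ge0 ?mu_fin.
have : mu K < mu K + mu K by rewrite lteDl.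
(* As [mu V < 2 mu K], the set [V] has no room for both [K] and a disjoint translate of [K]. *)
rewrite {1}outer_reg // => /ereal_inf_lt [_ [V [oV KV] <-] VK].
have W := compact_mulg_nbhs lcG cK oV KV.
have nH1 : nbhs (1%g : G) H.
  apply: filterS W => w wKV; apply: contrapT => nHw.
  have mwK : borel [set (w * x)%g | x in K] by exact: borel_mulgl.
  have : mu ([set (w * x)%g | x in K] `|` K) <= mu V.
    apply: borel_measure_le => //; last 2 first.
      exact: open_borel.
      by move=> x [[k Kk <-]|Kx]; [exact: wKV|exact: KV].
    exact: (@measurableU _ (borel_group G)).
  rewrite borel_measureU //; last first.
    rewrite -subset0 => _ [[k /KHL[Hk _] <-] /KHL[Hwk _]]; apply: nHw.
    by rewrite -(mulgK k w); apply: HM => //; rewrite -(mulg1 k^-1%g); exact: HV.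
  have -> : mu [set (w * x)%g | x in K] = mu K by rewrite image_mulgl haar_mulgl.
  by rewrite leNgt VK.
rewrite openE => x Hx.
have := nbhs_mulgl tG x nH1; apply: filterS => y /= Hxy.
by rewrite -(mulVKg x y); exact: HM.
Qed.

End steinhaus.

(** * Uniqueness of Haar measures on second countable groups *)

(** An open set is the union of the basic rectangles that it contains, and two countable bases
    provide only countably many of them. *)
Lemma open_setX_measurable (G H : preTopologicalGroupType) (W : set (G * H)) :
  @second_countable G -> @second_countable H -> open W ->
  measurable (W : set (borel_group G * borel_group H)).
Proof.
move=> /second_countable_seq_basis[U [oU UP]].
move=> /second_countable_seq_basis[V [oV VP]] oW.
have -> : W = \bigcup_n \bigcup_m
    (if pselect (U n `*` V m `<=` W) then U n `*` V m else set0).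
  rewrite predeqE => -[x y]; split=> [Wxy|[n _ [m _]]]; last first.
    by case: pselect => //= UVW xy; exact: UVW.
  have [[A B] /= [xA yB] ABW] : nbhs (x, y) W by exact: open_nbhs_nbhs.
  have [n [Ux UA]] := UP _ _ xA; have [m [Vy VB]] := VP _ _ yB.
  exists n => //; exists m => //; case: pselect => // nUVW.
  exfalso; apply: nUVW => -[a b] /= [Ua Vb].
  by apply: ABW; split; [exact: UA|exact: VB].
apply: bigcupT_measurable => n; apply: bigcupT_measurable => m.
case: pselect => UVW; last exact: measurable0.
by apply: measurableX; exact: open_borel.
Qed.

Lemma measurable_fun_openP (d : measure_display) (T : measurableType d)
    (G : preTopologicalGroupType) (f : T -> borel_group G) :
  (forall U : set G, open U -> measurable (f @^-1` U)) -> measurable_fun setT f.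
Proof.
move=> mf; apply: (@measurability _ _ T (borel_group G) setT f (@open G) erefl).
move=> _ [U oU <-].
by rewrite setTI; exact: mf.
Qed.

Section left_invariant_integral.
Local Open Scope ring_scope.
Local Open Scope ereal_scope.
Variables (R : realType) (G : preTopologicalGroupType).
Hypotheses (tG : topological_group G) (scG : @second_countable G).

Lemma measurable_mulg : measurable_fun setT
  (fun u : borel_group G * borel_group G => (u.1 * u.2)%g : borel_group G).
Proof.
apply: measurable_fun_openP => U oU; apply: open_setX_measurable => //.
by apply: open_comp => // x _; case: tG => + _; apply.
Qed.

Lemma measurable_fun_mulg (d : measure_display) (X : measurableType d)
    (f g : X -> borel_group G) : measurable_fun setT f -> measurable_fun setT g ->
  measurable_fun setT (fun x => (f x * g x)%g : borel_group G).
Proof.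
move=> mf mg; exact: (measurableT_comp measurable_mulg (measurable_fun_pair mf mg)).
Qed.

Lemma measurable_invg :
  measurable_fun setT (fun x : borel_group G => (x^-1)%g : borel_group G).
Proof.
apply: measurable_fun_openP => U oU; apply: open_borel.
by apply: open_comp => // x _; case: tG => _; apply.
Qed.

Lemma left_invariant_integral (mu : {measure set (borel_group G) -> \bar R})
    (f : borel_group G -> \bar R) (s : G) : left_invariant mu ->
  measurable_fun setT f -> (forall x, 0 <= f x) ->
  \int[mu]_x f (s * x)%g = \int[mu]_x f x.
Proof.
move=> mu_inv mf f0.
have ms : measurable_fun setT (fun x : borel_group G => (s * x)%g : borel_group G).
  apply: measurable_fun_openP => U oU; apply: open_borel.
  by apply: open_comp => // x _; exact: mulgl_continuous.
transitivity (\int[pushforward mu (fun x : borel_group G =>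
  (s * x)%g : borel_group G)]_x f x).
  by rewrite (ge0_integral_pushforward ms).
apply: eq_measure_integral => A mA _; rewrite /pushforward.
rewrite -[RHS](mu_inv s^-1%g) //; congr (mu _).
by rewrite image_mulgl invgK.
Qed.

Variables mu nu : {sigma_finite_measure set (borel_group G) -> \bar R}.
Hypotheses (mu_inv : left_invariant mu) (nu_inv : left_invariant nu).

(* Substitute [y := x^-1 y], exchange the integrals, then substitute
   [x := y x]. *)
Lemma left_invariant_exchange (C : set G) (h : borel_group G -> \bar R) :
  borel C -> measurable_fun setT h -> (forall x, 0 <= h x) ->
  mu C * \int[nu]_y h y =
  \int[mu]_x (h (x^-1)%g * nu [set y | C (y * x)%g]).
Proof.
move=> mC mh h0.
pose T := borel_group G.
have m1 : measurable_fun setT (fun x : T => (\1_(C : set T) x)%:E : \bar R).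
  by apply/measurable_EFinP; exact: measurable_indic.
have mC1 : measurable_fun setT (fun u : T * T =>
  (\1_(C : set T) (u.2 * u.1)%g)%:E : \bar R).
  apply: (measurableT_comp m1).
  exact: (measurable_fun_mulg measurable_snd measurable_fst).
have hv x : measurable_fun setT (fun y : T => h (x^-1 * y)%g).
  apply: (measurableT_comp mh).
  exact: (measurable_fun_mulg (measurable_cst _) (@measurable_id _ _ _)).
transitivity (\int[mu]_x \int[nu]_y ((\1_(C : set T) x)%:E * h (x^-1 * y)%g)).
  have -> : mu C = \int[mu]_x (\1_(C : set T) x)%:E
    by rewrite integral_indic // setIT.
  rewrite -ge0_integralZr //; last exact: integral_ge0.
  apply: eq_integral => x _; rewrite ge0_integralZl //.
  by rewrite (left_invariant_integral _ nu_inv mh).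
rewrite (fubini_tonelli (fun u : T * T =>
  (\1_(C : set T) u.1)%:E * h (u.1^-1 * u.2)%g)) /=; last 2 first.
  - apply: emeasurable_funM; first exact: (measurableT_comp m1 measurable_fst).
    apply: (measurableT_comp mh); apply: (measurable_fun_mulg _ measurable_snd).
    exact: (measurableT_comp measurable_invg measurable_fst).
  - by move=> u; rewrite mule_ge0 // lee_fin.
transitivity (\int[nu]_y \int[mu]_x ((\1_(C : set T) (y * x)%g)%:E * h (x^-1)%g)).
  apply: eq_integral => y _.
  rewrite -(left_invariant_integral y mu_inv) //.
  - by apply: eq_integral => x _; rewrite invgM mulgVK.
  - apply: emeasurable_funM => //.
    apply: (measurableT_comp mh).
    exact: (measurable_fun_mulg measurable_invg (measurable_cst _)).
  - by move=> x; rewrite mule_ge0 // lee_fin.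
rewrite -(fubini_tonelli (fun u : T * T =>
  (\1_(C : set T) (u.2 * u.1)%g)%:E * h (u.1^-1)%g)) /=; last 2 first.
  - apply: emeasurable_funM => //.
    exact: (measurableT_comp mh (measurableT_comp measurable_invg measurable_fst)).
  - by move=> u; rewrite mule_ge0 // lee_fin.
apply: eq_integral => x _.
have mCx : borel [set y | C (y * x)%g].
  by apply: (borel_preimage (@mulgr_continuous _ tG x)).
rewrite ge0_integralZr //; last exact: (measurableT_comp mC1 (measurable_pair1 x)).
rewrite muleC; congr (_ * _).
transitivity (\int[nu]_y (\1_([set y | C (y * x)%g] : set T) y)%:E).
  by apply: eq_integral => y _; rewrite !indicE.
by rewrite integral_indic // setIT.
Qed.

End left_invariant_integral.

(** * Proportionality to a Haar measure *)

Section haar_uniqueness.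
Local Open Scope ring_scope.
Local Open Scope ereal_scope.
Variables (R : realType) (G : preTopologicalGroupType).
Hypotheses (lcG : locally_compact_group G) (scG : @second_countable G).
Variables mu nu : {sigma_finite_measure set (borel_group G) -> \bar R}.
Hypotheses (mu_inv : left_invariant mu) (nuH : left_haar_measure nu).

(** The set is the translate [C x^-1], compact and with nonempty interior. These bounds allow
    division by its measure. *)
Lemma haar_mulgr_bounds (C : set G) (x : G) : compact C -> nbhs (1%g : G) C ->
  0 < nu [set y | C (y * x)%g] < +oo.
Proof.
have [tG hG lG] := lcG; have [[nu_fin _ _] _ _] := nuH.
move=> cC C1; have E : [set y | C (y * x)%g] = [set (y * x^-1)%g | y in C].
  by rewrite image_mulgr invgK.
have cCx : compact [set y | C (y * x)%g] by rewrite E; exact: compact_mulgr.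
rewrite nu_fin // andbT.
have oCx : open [set y | C° (y * x)%g].
  have /continuousP := @mulgr_continuous _ tG x.
  by move/(_ _ (open_interior C)).
apply: (@lt_le_trans _ _ (nu [set y | C° (y * x)%g])).
  by apply: haar_open_gt0 => //; exists x^-1%g; rewrite /= mulVg.
apply: borel_measure_le; [exact: open_borel|exact: compact_borel|].
by move=> y /= /interior_subset.
Qed.

(** In the exchange formula, take for [h y] the indicator of [F] at [y^-1] divided by [phi (y^-1)]:
    the factor [phi] cancels and the right side becomes [mu F]. As [mu] may vanish, [c] is only
    nonnegative. *)
Theorem haar_measure_unique : exists c : R,
  (0 <= c)%R /\ forall F : set G, borel F -> mu F = c%:E * nu F.
Proof.
have [tG hG lG] := lcG; have [_ nu_inv _] := nuH.
pose T := borel_group G.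
have [C cC C1] := locally_compact_nbhs (1%g : G) lG.
have mC := compact_borel hG cC.
pose phi (x : T) := nu [set y | C (y * x)%g].
have phi_bounds x : 0 < phi x < +oo by exact: haar_mulgr_bounds.
have mphi : measurable_fun setT phi.
  pose A : set (T * T) := (fun u : T * T => (u.2 * u.1)%g : T) @^-1` (C : set T).
  have mA : measurable A.
    rewrite -[A]setTI; apply: (measurable_fun_mulg tG scG measurable_snd
      measurable_fst) => //.
  have := measurable_fun_xsection nu mA; congr measurable_fun.
  by apply/funext => x /=; congr (nu _); apply/seteqP; split => y;
    rewrite /xsection /= inE.
pose r (x : T) : R := (fine (phi x) `^ (-1))%R.
have rphi x : (r x)%:E * phi x = 1.
  rewrite /r; case: (phi x) (phi_bounds x) => [a| |];
    rewrite ?ltxx ?andbF // lte_fin ltry andbT => a0 /=.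
  by rewrite powR_inv1 ?ltW // -EFinM mulVf // gt_eqF.
have mr : measurable_fun setT r.
  by apply: (measurableT_comp (measurable_powR _));
    exact: (measurableT_comp _ mphi).
(* [mu C * J F = mu F] holds for every left invariant [mu], with [J] independent
   of [mu]; comparing with [nu C * J F = nu F] gives the proportionality. *)
pose J (F : set G) := \int[nu]_y ((\1_(F : set T) (y^-1)%g)%:E * (r (y^-1)%g)%:E).
have JE (m : {sigma_finite_measure set T -> \bar R}) (F : set G) :
    left_invariant m -> borel F -> m C * J F = m F.
  move=> m_inv mF; rewrite /J.
  rewrite (left_invariant_exchange tG scG m_inv nu_inv mC
    (h := fun y => (\1_(F : set T) (y^-1)%g)%:E * (r (y^-1)%g)%:E)).
  - transitivity (\int[m]_x (\1_(F : set T) x)%:E);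
    last by rewrite integral_indic // setIT.
    apply: eq_integral => x _; rewrite !invgK -muleA.
    by have -> : (r x)%:E * nu [set y | C (y * x)%g] = 1 := rphi x; rewrite mule1.
  - apply: emeasurable_funM.
      have mF1 : measurable_fun setT (\1_(F : set T) : T -> R)
        by exact: measurable_indic.
      by apply/measurable_EFinP; exact: (measurableT_comp mF1 (measurable_invg tG)).
    apply/measurable_EFinP; exact: (measurableT_comp mr (measurable_invg tG)).
  - by move=> x; rewrite mule_ge0 // lee_fin // powR_ge0.
have J0 F : 0 <= J F.
  by apply: integral_ge0 => y _; rewrite mule_ge0 // lee_fin // powR_ge0.
have nuC : 0 < nu C < +oo.
  have := phi_bounds 1%g; rewrite /phi (_ : [set y | C (y * 1)%g] = C) //.
  by apply/seteqP; split => y /=; rewrite mulg1.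
have /andP[nuC0 nuCoo] := nuC.
(* Sigma-finiteness excludes an infinite [mu C]: some piece [F n] of finite [mu] has positive [nu],
   hence positive [J (F n)], and then [mu C * J (F n)] would be infinite. *)
have [muC|muC] := eqVneq (mu C) +oo.
  exfalso; have [F FT FP] := sigma_finiteT mu.
  have mF n : borel (F n) by have [] := FP n.
  have [n] : exists n, 0 < nu (F n).
    apply: borel_bigcup_gt0 => //.
    by rewrite -FT; apply: haar_open_gt0 => //; [exact: openT|exists 1%g].
  rewrite -(JE nu) // => nuF.
  have JF0 : 0 < J (F n).
    rewrite lt0e J0 andbT; apply/eqP => JF; move: nuF.
    by rewrite JF mule0 ltxx.
  have [_ /lt_eqF/eqP] := FP n; apply.
  by rewrite -[LHS](JE mu (F n) mu_inv (mF n)) muC gt0_mulye.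
have muCfin : mu C \is a fin_num by rewrite ge0_fin_numE ?measure_ge0 // ltey.
have nuCfin : nu C \is a fin_num by rewrite ge0_fin_numE ?measure_ge0.
exists (fine (mu C) / fine (nu C))%R; split.
  by rewrite divr_ge0 // fine_ge0 // measure_ge0.
move=> F mF; rewrite -(JE mu F mu_inv mF) -(JE nu F nu_inv mF) muleA.
congr (_ * _); rewrite -[in RHS](fineK nuCfin) -EFinM divfK ?fineK //.
by rewrite gt_eqF // fine_gt0.
Qed.

End haar_uniqueness.

(** * Modular functions *)

Section modular.
Local Open Scope ring_scope.
Local Open Scope ereal_scope.
Variables (R : realType) (G : preTopologicalGroupType).
Hypothesis lcG : locally_compact_group G.
Variable mu : {measure set (borel_group G) -> \bar R}.
Hypothesis muH : left_haar_measure mu.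
Variable Delta : G -> R.
Hypothesis DeltaE : forall (s : G) (B : set G), borel B ->
  mu [set (x * s)%g | x in B] = (Delta s)%:E * mu B.

(** A compact neighbourhood of [1] has finite positive measure, which can be cancelled. *)
Lemma modular_eq (a b : R) :
  (forall B : set G, borel B -> a%:E * mu B = b%:E * mu B) -> a = b.
Proof.
have [C [cC C1 mC]] := haar_compact_nbhd lcG muH.
move=> /andP[C0 Coo] /(_ C mC); rewrite -[mu C]fineK ?ge0_fin_numE ?ltW //.
by rewrite -!EFinM => -[]; apply: mulIf; rewrite gt_eqF // fine_gt0 // C0.
Qed.

Lemma modular_gt0 (s : G) : (0 < Delta s)%R.
Proof.
have [tG hG lG] := lcG.
have [C [cC C1 mC]] := haar_compact_nbhd lcG muH.
move=> /andP[C0 Coo]; rewrite -lte_fin.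
suff : 0 < (Delta s)%:E * mu C.
  have := measure_ge0 mu C; rewrite le_eqVlt eq_sym gt_eqF //= => _.
  by rewrite pmule_lgt0.
rewrite -DeltaE //; apply: (@lt_le_trans _ _ (mu [set x | C° (x * s^-1)%g])).
  apply: haar_open_gt0 => //; last by exists s; rewrite /= mulgV.
  by have /continuousP := @mulgr_continuous _ tG s^-1%g;
    move/(_ _ (open_interior C)).
apply: borel_measure_le; last first.
- by rewrite image_mulgr => x /= /interior_subset.
- exact: borel_mulgr.
- apply: open_borel.
  by have /continuousP := @mulgr_continuous _ tG s^-1%g;
    move/(_ _ (open_interior C)).
Qed.

Lemma modularM (s t : G) : Delta (s * t)%g = (Delta s * Delta t)%R.
Proof.
have [tG _ _] := lcG; apply: modular_eq => B mB;
  rewrite -DeltaE // mulrC EFinM -muleA.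
rewrite -DeltaE // -DeltaE; last exact: borel_mulgr.
by rewrite image_comp; congr (mu _); apply: eq_imagel => x _ /=; rewrite mulgA.
Qed.

Lemma modular1 : Delta 1%g = 1%R.
Proof.
apply: modular_eq => B mB; rewrite -DeltaE // mul1e eq_image_id // => x _.
exact: mulg1.
Qed.

Lemma modularVM (s t : G) : Delta s = 1%R -> Delta t = 1%R ->
  Delta (s^-1 * t)%g = 1%R.
Proof.
move=> s1 t1; rewrite modularM t1 mulr1.
by rewrite -[LHS]mul1r -s1 -modularM mulgV modular1.
Qed.

(** The preimage of a set under [x -> x s^-1] is its right translate by [s], so the image of [mu]
    under this map is [Delta s] times [mu]. *)
Lemma modular_integral (f : borel_group G -> \bar R) (s : G) :
  measurable_fun setT f -> (forall x, 0 <= f x) ->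
  \int[mu]_x f (x * s^-1)%g = (Delta s)%:E * \int[mu]_x f x.
Proof.
have [tG _ _] := lcG; move=> mf f0.
pose g (x : borel_group G) : borel_group G := (x * s^-1)%g.
have mg : measurable_fun setT g.
  apply: measurable_fun_openP => U oU; apply: open_borel.
  by apply: open_comp => // x _; exact: mulgr_continuous.
transitivity (\int[pushforward mu g]_x f x).
  by rewrite (ge0_integral_pushforward mg).
pose c : {nonneg R} := NngNum (ltW (modular_gt0 s)).
transitivity (\int[mscale c mu]_x f x); last by rewrite ge0_integral_mscale.
apply: eq_measure_integral => A mA _; rewrite /pushforward /mscale /=.
by transitivity (mu [set (x * s)%g | x in A]); [rewrite image_mulgr|exact: DeltaE].
Qed.

End modular.

(** * Integration over the fibers of the twisted product *)

(* [A] written multiplicatively, so that the theory of Haar measures applies. *)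
Definition multiplicative (A : topologicalZmodType) : Type := A.

Section multiplicative.
Variable A : topologicalZmodType.
Local Open Scope ring_scope.

HB.instance Definition _ := Topological.copy (multiplicative A) A.
HB.instance Definition _ := isGroup.Build (multiplicative A)
  (@addrA A) (@add0r A) (@addr0 A) (@addNr A) (@addrN A).

Lemma multiplicative_locally_compact : hausdorff_space A -> compact [set: A] ->
  locally_compact_group (multiplicative A).
Proof.
move=> hA cA; split => //.
  split; [exact: (@add_continuous A)|exact: (@opp_continuous A)].
by move=> x _; exists setT; [exact: filterT|split => //; exact: closedT].
Qed.

End multiplicative.

Section twisted_integral.
Local Open Scope ring_scope.
Local Open Scope ereal_scope.
Variables (R : realType) (G : preTopologicalGroupType) (A : topologicalZmodType).
Variable omega : normalized_borel_cocycle G A.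
Let E := twisted_product omega.
Let T := borel_group (multiplicative A).
Variables (muA : {measure set T -> \bar R}).
Variables (muG : {measure set (borel_group G) -> \bar R}).
Hypotheses (muA_inv : left_invariant muA) (muG_inv : left_invariant muG).
Hypothesis tG : topological_group G.

Definition fiber (B : set (A * G)) (s : G) : set A := [set a | B (a, s)].

(** Multiplication moves the base point and shifts each fiber by an element of [A] that depends on
    the base point. An invariant measure on [A] ignores the shift, so the cocycle disappears from
    the fiber integral. *)
Lemma fiber_mull (x : E) (B : set E) (s : G) :
  fiber [set (x * y)%g | y in B] s =
  [set (x.1 + omega (x.2, x.2^-1 * s)%g + a)%R | a in fiber B (x.2^-1 * s)%g].
Proof.
rewrite predeqE => a; split=> [[[b t] /= Bbt] [<- <-]|[b Bb <-]].
  by exists b; rewrite /fiber /= mulKg // addrAC.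
exists (b, (x.2^-1 * s)%g) => //.
by congr pair => /=; [rewrite addrAC|rewrite mulVKg].
Qed.

(** As [A] is commutative, right multiplication also acts on fibers by a left translation, so only
    the base point feels the side. *)
Lemma fiber_mulr (x : E) (B : set E) (s : G) :
  fiber [set (y * x)%g | y in B] s =
  [set (x.1 + omega (s * x.2^-1, x.2)%g + a)%R | a in fiber B (s * x.2^-1)%g].
Proof.
rewrite predeqE => a; split=> [[[b t] /= Bbt] [<- <-]|[b Bb <-]].
  by exists b; rewrite /fiber /= mulgK // addrC addrA.
exists (b, (s * x.2^-1)%g) => //.
by congr pair => /=; [rewrite -addrA addrC|rewrite mulgVK].
Qed.

(** A union of whole fibers absorbs the cocycle. Such sets carry measure identities from the
    extension back to [G]. *)
Lemma setX_mull (x : E) (B : set G) :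
  [set (x * y)%g | y in (setT `*` B : set E)] =
  (setT `*` [set (x.2 * s)%g | s in B] : set E).
Proof.
rewrite predeqE => -[a s]; split=> [[[b t] [_ Bt] [_ <-]]|[/= _ [t Bt <-]]].
  by split => //; exists t.
exists ((a - x.1 - omega (x.2, t))%R, t) => //.
by congr pair => /=; rewrite -addrA subrK addrC subrK.
Qed.

Lemma setX_mulr (x : E) (B : set G) :
  [set (y * x)%g | y in (setT `*` B : set E)] =
  (setT `*` [set (s * x.2)%g | s in B] : set E).
Proof.
rewrite predeqE => -[a s]; split=> [[[b t] [_ Bt] [_ <-]]|[/= _ [t Bt <-]]].
  by split => //; exists t.
exists ((a - x.1 - omega (t, x.2))%R, t) => //.
by congr pair => /=; rewrite addrAC subrK subrK.
Qed.

Definition twisted_integral (B : set (A * G)) :=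
  \int[muG]_s muA (fiber B s).

Variable B : set E.
Hypotheses (mB : forall s, borel (fiber B s))
  (mfB : measurable_fun setT (fun s : borel_group G => muA (fiber B s))).

Lemma twisted_integral_mull (x : E) :
  twisted_integral [set (x * y)%g | y in B] = twisted_integral B.
Proof.
rewrite /twisted_integral -[RHS](left_invariant_integral tG x.2^-1%g muG_inv mfB)//.
by apply: eq_integral => s _; rewrite fiber_mull; exact: muA_inv.
Qed.

Lemma twisted_integral_mulr (Delta : G -> R) (x : E) :
  locally_compact_group G -> left_haar_measure muG ->
  (forall (s : G) (C : set G), borel C ->
    muG [set (y * s)%g | y in C] = (Delta s)%:E * muG C) ->
  twisted_integral [set (y * x)%g | y in B] = (Delta x.2)%:E * twisted_integral B.
Proof.
move=> lcG muH DeltaE.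
rewrite /twisted_integral -(modular_integral lcG muH DeltaE _ mfB) //.
by apply: eq_integral => s _; rewrite fiber_mulr; exact: muA_inv.
Qed.

End twisted_integral.

(** * The Mackey topology *)

Section sigma_finite_copy.
Local Open Scope ring_scope.
Context (d : measure_display) (T : measurableType d) (R : realType).
Variable mu : {measure set T -> \bar R}.
Hypothesis sf_mu : sigma_finite setT mu.

(* The library's Fubini theorems want sigma-finiteness as a canonical structure
   rather than as a hypothesis. *)
Definition sigma_finite_copy of sigma_finite setT mu : set T -> \bar R := mu.

HB.instance Definition _ := Measure.copy (sigma_finite_copy sf_mu) mu.
HB.instance Definition _ :=
  @Measure_isSigmaFinite.Build _ T R (sigma_finite_copy sf_mu) sf_mu.

End sigma_finite_copy.

Section second_countable_haar.
Local Open Scope ring_scope.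
Local Open Scope ereal_scope.
Variables (R : realType) (G : preTopologicalGroupType).
Hypotheses (lcG : locally_compact_group G) (scG : @second_countable G).

Lemma haar_sigma_finite (mu : {measure set (borel_group G) -> \bar R}) :
  left_haar_measure mu -> sigma_finite setT mu.
Proof.
move=> [[mu_fin _ _] _ _]; have [_ hG _] := lcG.
have [K [cK KT]] := sigma_compact_group lcG scG.
exists K; first by apply/esym; rewrite -subTset => x _; have [n Kx] := KT x;
  exists n.
by move=> n; split; [exact: compact_borel|exact: mu_fin].
Qed.

Lemma haar_measure_proportional (mu nu : {measure set (borel_group G) -> \bar R}) :
  sigma_finite setT mu -> left_invariant mu -> left_haar_measure nu ->
  exists c : R, (0 <= c)%R /\ forall F : set G, borel F -> mu F = c%:E * nu F.
Proof.
move=> sfmu mu_inv nuH; have sfnu := haar_sigma_finite nuH.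
exact: (haar_measure_unique lcG scG
  (mu := sigma_finite_copy sfmu) (nu := sigma_finite_copy sfnu) mu_inv nuH).
Qed.

End second_countable_haar.

Lemma EFin_mulI (R : realType) (c : R) :
  c != 0%R -> injective (fun z : \bar R => c%:E * z)%E.
Proof.
move=> c0 a b /(congr1 (fun z => (c^-1)%:E * z)%E) /=.
by rewrite !muleA -!EFinM mulVf // !mul1e.
Qed.

Section mackey.
Local Open Scope ring_scope.
Local Open Scope ereal_scope.
Variables (R : realType) (G : preTopologicalGroupType) (A : topologicalZmodType).
Hypotheses (lcG : locally_compact_group G) (scG : @second_countable G).
Hypotheses (hA : hausdorff_space A) (cA : compact [set: A]).
Variables (omega : normalized_borel_cocycle G A).
Variable tau : topology (twisted_product omega).
Hypothesis tauM : is_mackey_topology tau.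

Let E := topologized tau.
Let TA := borel_group (multiplicative A).
Let TG := borel_group G.
Let lcE : locally_compact_group E. Proof. by case: tauM. Qed.
Let scE : @second_countable E. Proof. by case: tauM. Qed.
Let lcA := multiplicative_locally_compact hA cA.

(** This identity gives access to product measures and sections on [E], whose topology is otherwise
    known only as that of a locally compact second countable group. *)
Let borelE : @borel E = @measurable _ (TA * TG)%type.
Proof. by case: tauM => _ _ ->; rewrite measurable_prod_measurableType. Qed.

Variables (muA : {measure set TA -> \bar R}) (muG : {measure set TG -> \bar R}).
Hypotheses (muAH : left_haar_measure muA) (muGH : left_haar_measure muG).

Lemma compact_haar_bounds : 0 < muA [set: A] < +oo.
Proof.
apply/andP; split; last by case: muAH => -[fin _ _] _ _; exact: fin.
by apply: (haar_open_gt0 lcA muAH); [exact: openT|exists (0%R : A)].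
Qed.

Let sfA : sigma_finite setT muA.
Proof.
exists (fun=> setT); first by apply/esym; rewrite -subTset => x _; exists 0%N.
by move=> n; split; [exact: measurableT|case/andP: compact_haar_bounds].
Qed.

Let m := sigma_finite_copy sfA.
Let Q : set (borel_group E) -> \bar R := m \x^ muG.

Let QE (B : set E) : Q B = twisted_integral muA muG B.
Proof.
apply: eq_integral => s _ /=; congr (muA _).
by apply/seteqP; split => a; rewrite /ysection /= inE.
Qed.

Let Q_sigma_additive : semi_sigma_additive Q.
Proof.
move=> F mF tF mUF; apply: (@measure_semi_sigma_additive _ _ _ (m \x^ muG)) => //.
  by move=> i; rewrite -borelE; exact: mF.
by rewrite -borelE.
Qed.

HB.instance Definition _ := isMeasure.Build _ (borel_group E) R Q
  (measure0 (m \x^ muG)) (measure_ge0 (m \x^ muG)) Q_sigma_additive.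

Let fiber_borel (B : set E) s : borel B -> borel (fiber B s).
Proof.
rewrite borelE => mB;
  have := @measurable_ysection _ _ TA TG (B : set (TA * TG)) s mB.
by congr borel; apply/seteqP; split => a; rewrite /ysection /= inE.
Qed.

Let fiber_measurable (B : set E) : borel B ->
  measurable_fun setT (fun s : TG => muA (fiber B s)).
Proof.
rewrite borelE => mB; have := measurable_fun_ysection m mB; congr measurable_fun.
apply/funext => s /=; congr (muA _).
by apply/seteqP; split => a; rewrite /ysection /= inE.
Qed.

Let Q_setX (B : set G) : borel B -> Q (setT `*` B) = muA setT * muG B.
Proof. by move=> mB; rewrite /Q product_measure2E. Qed.

Lemma setX_borel (B : set G) : borel B -> @borel E (setT `*` B).
Proof. by move=> mB; rewrite borelE; exact: measurableX. Qed.

Lemma slice_borel (B : set E) (a : A) : borel B -> borel [set s : G | B (a, s)].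
Proof.
rewrite borelE => mB;
  have := @measurable_xsection _ _ TA TG (B : set (TA * TG)) a mB.
by congr borel; apply/seteqP; split => s; rewrite /xsection /= inE.
Qed.

Let Q_mull (x : E) (B : set E) : borel B -> Q [set (x * y)%g | y in B] = Q B.
Proof.
move=> mB; have [_ muA_inv _] := muAH; have [_ muG_inv _] := muGH.
rewrite !QE; apply: twisted_integral_mull => //; first by case: lcG.
- by move=> s; exact: fiber_borel.
- exact: fiber_measurable.
Qed.

Let Q_mulr (Delta : G -> R) (x : E) (B : set E) :
  (forall (s : G) (C : set G), borel C ->
    muG [set (y * s)%g | y in C] = (Delta s)%:E * muG C) ->
  borel B -> Q [set (y * x)%g | y in B] = (Delta x.2)%:E * Q B.
Proof.
move=> DeltaE mB; have [_ muA_inv _] := muAH.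
rewrite !QE; apply: (@twisted_integral_mulr R G A omega muA muG muA_inv) => //.
- by move=> s; exact: fiber_borel.
- exact: fiber_measurable.
Qed.

Let Q_sigma_finite : sigma_finite setT Q.
Proof.
have [F FT FP] := haar_sigma_finite lcG scG muGH.
exists (fun n => setT `*` F n).
  rewrite predeqE => -[a s]; split=> // _; have : setT s by [].
  by rewrite FT => -[n _ Fns]; exists n.
move=> n; have [mF Foo] := FP n; split; first exact: setX_borel.
by rewrite Q_setX //; apply: lte_mul_pinfty => //; rewrite ge0_fin_numE //;
  case/andP: compact_haar_bounds.
Qed.

Section proportional.
Variable muE : {measure set (borel_group E) -> \bar R}.
Hypothesis muEH : left_haar_measure muE.

Let Q_proportional : exists c : R,
  (0 < c)%R /\ forall B : set E, borel B -> Q B = c%:E * muE B.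
Proof.
have [c [c0 QcE]] := haar_measure_proportional lcE scE (mu := Q)
  Q_sigma_finite Q_mull muEH.
exists c; split => //; rewrite lt_neqAle c0 andbT; apply/eqP => c_eq0.
(* A zero constant would make [Q] vanish, whereas the total mass is the product of two nonzero
   masses. *)
have : Q setT != 0.
  rewrite -setXTT Q_setX; last by apply: open_borel; exact: openT.
  rewrite mule_neq0 //; last by case: muGH.
  by case: muAH.
by rewrite QcE; [rewrite -c_eq0 mul0e eqxx|apply: open_borel; exact: openT].
Qed.

(** Right translation by [x] scales [Q] by [Delta x.2], and [muE] is proportional to [Q] with a
    nonzero constant that cancels. *)
Lemma mackey_modular (Delta : G -> R) :
  (forall (s : G) (B : set G), borel B ->
    muG [set (y * s)%g | y in B] = (Delta s)%:E * muG B) ->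
  forall (x : E) (B : set E), borel B ->
    muE [set (y * x)%g | y in B] = (Delta x.2)%:E * muE B.
Proof.
move=> DeltaE x B mB; have [c [c0 QcE]] := Q_proportional.
have := Q_mulr x DeltaE mB; rewrite !QcE //; last first.
  by apply: borel_mulgr => //; case: lcE.
by rewrite muleCA; apply: EFin_mulI; rewrite gt_eqF.
Qed.

(** The scaling rule on [E] is tested on the unions of fibers over [B], of [Q]-mass [muA A * muG B];
    the finite positive factor [muA A] cancels. *)
Lemma mackey_modular_quotient (Delta : E -> R) :
  (forall (x : E) (B : set E), borel B ->
    muE [set (y * x)%g | y in B] = (Delta x)%:E * muE B) ->
  forall (x : E) (B : set G), borel B ->
    muG [set (y * x.2)%g | y in B] = (Delta x)%:E * muG B.
Proof.
move=> DeltaE x B mB; have [c [c0 QcE]] := Q_proportional.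
have mTB := setX_borel mB.
have mBx : borel [set (y * x.2)%g | y in B] by apply: borel_mulgr => //; case: lcG.
have : Q (setT `*` [set (y * x.2)%g | y in B]) = (Delta x)%:E * Q (setT `*` B).
  rewrite !QcE //; last exact: setX_borel.
  by rewrite -(setX_mulr (omega := omega)) DeltaE // muleCA.
rewrite !Q_setX // muleCA.
have /andP[muA0 muAoo] := compact_haar_bounds.
have <- : (fine (muA setT))%:E = muA setT by rewrite fineK ?ge0_fin_numE ?ltW.
have fmuA0 : (fine (muA setT) != 0)%R by rewrite gt_eqF // fine_gt0 // muA0.
exact: EFin_mulI.
Qed.

End proportional.

End mackey.

(** * The equivalence for the Mackey topology *)

Section mackey_theorem.
Local Open Scope ring_scope.
Variables (R : realType) (G : preTopologicalGroupType) (A : topologicalZmodType).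
Hypotheses (lcG : locally_compact_group G) (scG : @second_countable G).
Hypotheses (hA : hausdorff_space A) (cA : compact [set: A]).
Variables (omega : normalized_borel_cocycle G A).
Variable tau : topology (twisted_product omega).
Hypothesis tauM : is_mackey_topology tau.

Let E := topologized tau.

Lemma mackey_almost_unimodular :
  almost_unimodular R G <-> almost_unimodular R E.
Proof.
have [lcE scE _] := tauM; have lcA := multiplicative_locally_compact hA cA.
have [muA muAH] := haar_measure_exists R lcA.
split.
- move=> [Delta [muG muGH DeltaE] oker].
  have [muE muEH] := haar_measure_exists R lcE.
  exists (fun x : E => Delta x.2).
    by exists muE => //;
      exact: (mackey_modular lcG scG hA cA tauM muAH muGH muEH DeltaE).
  have nker : nbhs (1%g : G) [set s | Delta s = 1].
    by apply: open_nbhs_nbhs; split => //; exact: (modular1 lcG muGH DeltaE).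
  have [tG _ _] := lcG.
  (* Countably many cosets of the open kernel cover [G]; the elements [(0, u n)] then represent the
     cosets of the kernel in [E]. *)
  have [u uP] := second_countable_subcover (1%g : G) scG (fun s =>
    nbhs_mulgl tG s nker).
  apply: (@borel_subgroup_open R E lcE scE muE muEH _ (fun n => (0, u n) : E)).
  + have -> : [set x : E | Delta x.2 = 1] = setT `*` [set s | Delta s = 1].
      by apply/seteqP; split => [x|x []].
    by apply: setX_borel => //; exact: open_borel.
  + by move=> x y /= x1 y1; exact: (modularVM lcG muGH DeltaE).
  + by move=> x y /= x1 y1; rewrite (modularM lcG muGH DeltaE) x1 y1 mulr1.
  + by move=> x; have [n un] := uP x.2; exists n.
- move=> [Delta [muE muEH DeltaE] oker].
  have [muG muGH] := haar_measure_exists R lcG.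
  have DeltaGE := mackey_modular_quotient lcG scG hA cA tauM muAH muGH muEH DeltaE.
  pose D (s : G) : R := Delta ((0, s) : E).
  have DE (s : G) (B : set G) : borel B ->
      muG [set (x * s)%g | x in B] = ((D s)%:E * muG B)%E.
    by move=> mB; exact: (DeltaGE (0, s) B mB).
  (* Right translation of [G] by [x.2] scales [muG] both by [Delta x] and by [Delta (0, x.2)], so
     the modular function of [E] factors through [G]. *)
  have DeltaD x : Delta x = D x.2.
    apply: (modular_eq lcG muGH) => B mB.
    by rewrite -(DeltaGE x B mB) (DE x.2 B mB).
  exists D; first by exists muG.
  have nker : nbhs (1%g : E) [set x | Delta x = 1].
    by apply: open_nbhs_nbhs; split => //; exact: (modular1 lcE muEH DeltaE).
  have [tE _ _] := lcE.
  have [u uP] := second_countable_subcover (1%g : E) scE (fun x =>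
    nbhs_mulgl tE x nker).
  apply: (@borel_subgroup_open R G lcG scG muG muGH _ (fun n => (u n).2)).
  (* The kernel of [D] is the slice at [0] of an open set of [E]; it is Borel because Borel sets of
     [E] are measurable for the product. *)
  + exact: (slice_borel tauM 0 (open_borel oker)).
  + by move=> x y /= x1 y1; exact: (modularVM lcG muGH DE).
  + by move=> x y /= x1 y1; rewrite (modularM lcG muGH DE) x1 y1 mulr1.
  + move=> s; have [n un] := uP ((0, s) : E); exists n.
    by move: un; rewrite /= DeltaD.
Qed.

End mackey_theorem.

(** * Continuous cocycles *)

Lemma usc_measurable (R : realType) (G : preTopologicalGroupType)
    (f : borel_group G -> \bar R) :
  (forall r : R, open [set s : G | f s < r%:E]%E) -> measurable_fun setT f.
Proof.
move=> usc; apply: (@measurability _ _ (borel_group G) (\bar R) setT f _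
  (ErealGenInftyO.measurableE R)).
move=> _ [_ [r ->] <-]; rewrite setTI; apply: open_borel.
have := usc r; congr open; apply/seteqP; split=> s /=; rewrite in_itv //=.
Qed.

Lemma hausdorff_setX (X Y : topologicalType) :
  hausdorff_space X -> hausdorff_space Y -> hausdorff_space (X * Y)%type.
Proof.
move=> hX hY p q pq; apply: injective_projections.
  apply: hX => U V pU qV; have [] := pq (fst @^-1` U) (fst @^-1` V).
  + exact: (@cvg_fst X Y (nbhs p.1) (nbhs p.2) _ U pU).
  + exact: (@cvg_fst X Y (nbhs q.1) (nbhs q.2) _ V qV).
  + by move=> x [Ux Vx]; exists x.1.
apply: hY => U V pU qV; have [] := pq (snd @^-1` U) (snd @^-1` V).
+ exact: (@cvg_snd X Y (nbhs p.1) (nbhs p.2) _ U pU).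
+ exact: (@cvg_snd X Y (nbhs q.1) (nbhs q.2) _ V qV).
+ by move=> x [Ux Vx]; exists x.2.
Qed.

Section topological_zmodule.
Variable A : topologicalZmodType.
Local Open Scope ring_scope.

Lemma add_cvg (I : Type) (F : set_system I) (f g : I -> A) (a b : A) : Filter F ->
  f @ F --> a -> g @ F --> b -> (fun i => f i + g i) @ F --> a + b.
Proof.
by move=> FF fa gb; apply: continuous2_cvg fa gb; exact: (@add_continuous A (a, b)).
Qed.

Lemma opp_cvg (I : Type) (F : set_system I) (f : I -> A) (a : A) : Filter F ->
  f @ F --> a -> (fun i => - f i) @ F --> - a.
Proof. by move=> FF fa; apply: continuous_cvg fa; exact: (@opp_continuous A a). Qed.

End topological_zmodule.

(** * The extension with the product topology *)

Section product_topology.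
Variables (G : preTopologicalGroupType) (A : topologicalZmodType).
Hypotheses (lcG : locally_compact_group G).
Hypotheses (hA : hausdorff_space A) (cA : compact [set: A]).
Variables (omega : normalized_borel_cocycle G A).
Variable tau : topology (twisted_product omega).
Hypotheses (omega_cont : continuous omega) (tauP : is_product_topology tau).

Let E := topologized tau.

Lemma product_open (U : set (A * G)) : @open E U <-> @open (A * G)%type U.
Proof. by rewrite -[@open E]/(opens tau) tauP. Qed.

Lemma product_nbhs (x : E) (U : set (A * G)) :
  nbhs x U <-> nbhs (x : A * G) U.
Proof.
rewrite !nbhsE; split=> -[V [oV Vx] VU]; exists V => //; split=> //;
  exact/product_open.
Qed.

Lemma product_fst_continuous : continuous (fst : E -> A).
Proof. move=> x U xU; apply/product_nbhs.
exact: (@cvg_fst A G (nbhs x.1) (nbhs x.2) _ U xU). Qed.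

Lemma product_snd_continuous : continuous (snd : E -> G).
Proof. move=> x U xU; apply/product_nbhs.
exact: (@cvg_snd A G (nbhs x.1) (nbhs x.2) _ U xU). Qed.

Lemma product_cvg_pair (I : Type) (F : set_system I) (f : I -> A) (g : I -> G)
    (a : A) (s : G) : Filter F -> f @ F --> a -> g @ F --> s ->
  (fun i => (f i, g i) : E) @ F --> ((a, s) : E).
Proof.
move=> FF fa gs U /product_nbhs aU.
have h : (fun i => (f i, g i)) @ F --> ((a, s) : A * G) by exact: cvg_pair.
exact: (h U aU).
Qed.

Lemma product_compact (K : set (A * G)) : @compact E K <-> @compact (A * G)%type K.
Proof.
split=> cK.
  have := @continuous_compact E (A * G)%type id K _ cK; rewrite image_id; apply.
  apply: continuous_subspaceT; apply/continuousP => U oU; exact/product_open.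
have := @continuous_compact (A * G)%type E id K _ cK; rewrite image_id; apply.
apply: continuous_subspaceT; apply/continuousP => U oU; exact/product_open.
Qed.

Lemma twisted_inv_cvg (I : Type) (F : set_system I) (f : I -> A) (g : I -> G)
    (a : A) (s : G) : Filter F -> f @ F --> a -> g @ F --> s ->
  (fun i => twisted_inv ((f i, g i) : twisted_product omega) : E) @ F -->
  (twisted_inv ((a, s) : twisted_product omega) : E).
Proof.
move=> FF fa gs; have [tG _ _] := lcG.
have gV : (fun i => (g i)^-1)%g @ F --> (s^-1)%g by exact: (invg_cvg tG).
apply: product_cvg_pair => //; apply: add_cvg; first exact: opp_cvg.
apply: opp_cvg; apply: continuous_cvg; first exact: omega_cont.
exact: cvg_pair.
Qed.

Lemma product_locally_compact_group : locally_compact_group E.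
Proof.
have [tG hG lG] := lcG; have [cM cV] := tG; split.
- split.
    have f1 := @product_fst_continuous; have f2 := @product_snd_continuous.
    move=> [x y].
    have fx1 : (fun u : E * E => u.1.1) @ (x, y) --> x.1.
      by apply: continuous_cvg; [exact: f1|exact: cvg_fst].
    have fx2 : (fun u : E * E => u.1.2) @ (x, y) --> x.2.
      by apply: continuous_cvg; [exact: f2|exact: cvg_fst].
    have fy1 : (fun u : E * E => u.2.1) @ (x, y) --> y.1.
      by apply: continuous_cvg; [exact: f1|exact: cvg_snd].
    have fy2 : (fun u : E * E => u.2.2) @ (x, y) --> y.2.
      by apply: continuous_cvg; [exact: f2|exact: cvg_snd].
    apply: product_cvg_pair; last exact: mulg_cvg.
    apply: add_cvg; first exact: add_cvg.
    by apply: continuous_cvg; [exact: omega_cont|exact: cvg_pair].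
  move=> x.
  have fx1 : (fun u : E => u.1) @ x --> x.1 by exact: product_fst_continuous.
  have fx2 : (fun u : E => u.2) @ x --> x.2 by exact: product_snd_continuous.
  exact: (twisted_inv_cvg (nbhs_filter x) fx1 fx2).
- move=> p q pq; apply: (hausdorff_setX hA hG) => U V pU qV.
  by apply: pq; exact/product_nbhs.
- move=> x _; have [K cK xK] := locally_compact_nbhs x.2 lG.
  exists (setT `*` K : set E).
    rewrite withinET; apply/product_nbhs.
    by exists (setT, K) => //; split => //; exact: filterT.
  split; first by apply/product_compact; exact: compact_setX.
  have cK' := compact_closed hG cK.
  rewrite -[X in closed X]setCK; apply: open_closedC.
  have -> : ~` (setT `*` K : set E) = snd @^-1` (~` K).
    by rewrite predeqE => -[a s]; split=> [nK Ks|nK [_ Ks]]; [apply: nK|apply: nK].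
  apply: open_comp; last exact: closed_openC.
  by move=> u _; exact: product_snd_continuous.
Qed.

End product_topology.

(** * The fiber integral as a content *)

Section product_content.
Local Open Scope ring_scope.
Local Open Scope ereal_scope.
Variables (R : realType) (G : preTopologicalGroupType) (A : topologicalZmodType).
Hypotheses (lcG : locally_compact_group G).
Hypotheses (hA : hausdorff_space A) (cA : compact [set: A]).
Let TA := borel_group (multiplicative A).
Let TG := borel_group G.
Variables (muA : {measure set TA -> \bar R}) (muG : {measure set TG -> \bar R}).
Hypotheses (muAH : left_haar_measure muA) (muGH : left_haar_measure muG).

Let hG : hausdorff_space G. Proof. by case: lcG. Qed.

Lemma setX_fst_continuous (s : G) : continuous (fun a : A => (a, s)).
Proof. by move=> a; apply: cvg_pair => //; exact: cvg_cst. Qed.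

Lemma compact_fiber (K : set (A * G)) (s : G) : compact K -> compact (fiber K s).
Proof.
move=> cK; apply: (subclosed_compact _ cA) => //.
have cKl := compact_closed (hausdorff_setX hA hG) cK.
rewrite -[X in closed X]setCK; apply: open_closedC.
apply: (open_comp (f := fun a : A => (a, s)) (D := ~` K)); last exact: closed_openC.
by move=> a _; exact: setX_fst_continuous.
Qed.

Lemma compact_fiber_borel (K : set (A * G)) (s : G) : compact K ->
  @borel (multiplicative A) (fiber K s).
Proof. by move=> cK; apply: (@compact_borel (multiplicative A)) => //;
  exact: compact_fiber. Qed.

(** The complement is the projection to [G] of a compact set, namely the part of [K] whose first
    coordinate lies outside [U]. *)
Lemma open_fiber_subset (K : set (A * G)) (U : set A) : compact K -> open U ->
  open [set s | fiber K s `<=` U].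
Proof.
move=> cK oU; have -> : [set s | fiber K s `<=` U] =
  ~` (snd @` (K `\` fst @^-1` U)).
  rewrite predeqE => s; split=> [KU [[a t] [/= Kat nUa] ts]|nK a Kas].
    by apply/nUa/KU; rewrite /fiber /= -ts.
  by apply: contrapT => nUa; apply: nK; exists (a, s).
apply: closed_openC; apply: compact_closed => //.
apply: continuous_compact; first by apply: continuous_subspaceT => x;
  exact: cvg_snd.
apply: compactI_open_compl => //; apply: open_comp => // x _.
exact: cvg_fst.
Qed.

(** A compact set need not be measurable for the product of the Borel structures here, so upper
    semicontinuity is used: an open [U] around a fiber, of nearly the same measure, contains the
    neighbouring fibers. *)
Lemma compact_fiber_measurable (K : set (A * G)) : compact K ->
  measurable_fun setT (fun s : TG => muA (fiber K s)).
Proof.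
move=> cK; apply: usc_measurable => r; rewrite openE => s /= Ks.
have [[_ outer_reg _] _ _] := muAH.
move: Ks; rewrite outer_reg; last exact: compact_fiber_borel.
move=> /ereal_inf_lt[_ [U [oU KU] <-] Ur].
have : nbhs s [set s | fiber K s `<=` U].
  by apply: open_nbhs_nbhs; split => //; exact: open_fiber_subset.
apply: filterS => t KtU; apply: le_lt_trans Ur.
apply: borel_measure_le => //; first exact: compact_fiber_borel.
exact: open_borel.
Qed.

Let muA_bounds : 0 < muA setT < +oo := compact_haar_bounds hA cA muAH.

Lemma product_content : @compact_content R (A * G)%type (twisted_integral muA muG).
Proof.
have [[muG_fin _ _] _ _] := muGH; have /andP[muA0 muAoo] := muA_bounds.
split.
- move=> K cK; rewrite integral_ge0 //=.
  have cK2 : compact (snd @` K).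
    by apply: continuous_compact => //; apply: continuous_subspaceT => x;
      exact: cvg_snd.
  have mK2 := compact_borel hG cK2.
  have m1 : measurable_fun setT (fun s : TG =>
    (\1_(snd @` K : set TG) s)%:E : \bar R).
    by apply/measurable_EFinP; exact: measurable_indic.
  (* Fibers are empty off the compact projection of [K] and have measure at most [muA A] over it. *)
  apply: (@le_lt_trans _ _ (\int[muG]_s (muA setT * (\1_(snd @` K : set TG)
    s)%:E))).
    apply: ge0_le_integral => //.
    + exact: compact_fiber_measurable.
    + exact: measurable_funeM.
    + move=> s _; rewrite indicE; case: (boolP (s \in _)) => Ks.
        rewrite mule1; apply: borel_measure_le => //;
          first exact: compact_fiber_borel.
        by apply: open_borel; exact: openT.
      rewrite mule0 (_ : fiber K s = set0) ?measure0 // -subset0 => a Kas.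
      by move/negP: Ks; apply; apply/mem_set; exists (a, s).
  rewrite ge0_integralZl // ?integral_indic // ?setIT //.
  apply: lte_mul_pinfty; [exact: ltW|by rewrite ge0_fin_numE ?ltW|exact: muG_fin].
- move=> K L cK cL KL; apply: ge0_le_integral => //.
  + exact: compact_fiber_measurable.
  + exact: compact_fiber_measurable.
  + move=> s _; apply: borel_measure_le;
    [exact: compact_fiber_borel|exact: compact_fiber_borel|].
    by move=> a; exact: KL.
- move=> K L cK cL; rewrite /twisted_integral -ge0_integralD //; last 2 first.
  + exact: compact_fiber_measurable.
  + exact: compact_fiber_measurable.
  apply: ge0_le_integral => //.
  + by apply: compact_fiber_measurable; exact: compactU.
  + by apply: emeasurable_funD; exact: compact_fiber_measurable.
  + move=> s _; have mKs := compact_fiber_borel s cK;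
    have mLs := compact_fiber_borel s cL.
    exact: (measureU2 muA mKs mLs).
- move=> K L cK cL KL; rewrite /twisted_integral -ge0_integralD //; last 2 first.
  + exact: compact_fiber_measurable.
  + exact: compact_fiber_measurable.
  apply: eq_integral => s _; apply: borel_measureU.
  + exact: compact_fiber_borel.
  + exact: compact_fiber_borel.
  + rewrite -subset0 => a [Kas Las].
    have : (K `&` L) (a, s) by [].
    by rewrite KL.
Qed.

Lemma product_content_setX (C : set G) : borel C ->
  twisted_integral muA muG (setT `*` C) = muA setT * muG C.
Proof.
move=> mC; have /andP[muA0 muAoo] := muA_bounds.
have m1 : measurable_fun setT (fun s : TG => (\1_(C : set TG) s)%:E : \bar R).
  by apply/measurable_EFinP; exact: measurable_indic.
transitivity (\int[muG]_s (muA setT * (\1_(C : set TG) s)%:E)); last first.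
  by rewrite ge0_integralZl // ?integral_indic // ?setIT //.
apply: eq_integral => s _; rewrite indicE; case: (boolP (s \in _)) => Cs.
  rewrite mule1; congr (muA _); apply/seteqP; split=> // a _; split => //=.
  exact: set_mem.
rewrite mule0 (_ : fiber _ s = set0) ?measure0 // -subset0 => a [_ /= Cs'].
by move/negP: Cs; apply; exact: mem_set.
Qed.

End product_content.

Lemma pushforward_measureP (d1 d2 : measure_display) (T1 : measurableType d1)
    (T2 : measurableType d2) (R : realType) (mu : {measure set T1 -> \bar R}%R)
    (f : T1 -> T2) : measurable_fun setT f ->
  exists m : {measure set T2 -> \bar R}%R, forall B, m B = mu (f @^-1` B).
Proof. by move=> mf; unshelve eexists (pushforward mu f). Qed.

(** * The equivalence for continuous cocycles *)

Section continuous_cocycle.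
Local Open Scope ring_scope.
Local Open Scope ereal_scope.
Variables (R : realType) (G : preTopologicalGroupType) (A : topologicalZmodType).
Hypotheses (lcG : locally_compact_group G).
Hypotheses (hA : hausdorff_space A) (cA : compact [set: A]).
Variables (omega : normalized_borel_cocycle G A).
Variable tau : topology (twisted_product omega).
Hypotheses (omega_cont : continuous omega) (tauP : is_product_topology tau).

Let E := topologized tau.
Let lcE : locally_compact_group E.
Proof. exact: product_locally_compact_group. Qed.
Let tE : topological_group E. Proof. by case: lcE. Qed.
Let hE : hausdorff_space E. Proof. by case: lcE. Qed.
Let lE : locally_compact [set: E]. Proof. by case: lcE. Qed.
Let tG : topological_group G. Proof. by case: lcG. Qed.
Let hG : hausdorff_space G. Proof. by case: lcG. Qed.

Lemma product_almost_unimodular : almost_unimodular R G -> almost_unimodular R E.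
Proof.
move=> [Delta [muG muGH DeltaE] oker].
have lcA := multiplicative_locally_compact hA cA.
have [muA muAH] := haar_measure_exists R lcA.
have [_ muA_inv _] := muAH; have [_ muG_inv muG_neq0] := muGH.
have /andP[muA0 muAoo] := compact_haar_bounds hA cA muAH.
pose lam : set E -> \bar R := twisted_integral muA muG.
have cE (K : set E) : compact K -> @compact (A * G)%type K
  by move/product_compact; apply.
have lamP : compact_content lam.
  have [l1 l2 l3 l4] := product_content lcG hA cA muAH muGH.
  split=> [K cK|K L cK cL|K L cK cL|K L cK cL].
  - by apply: l1; exact: cE.
  - by apply: l2; exact: cE.
  - by apply: l3; exact: cE.
  - by apply: l4; exact: cE.
(* Since [muE] is the outer content of [lam], its left invariance and right scaling need to be
   checked for [lam] on compact sets only. *)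
have [muE [muE_radon muEE lam_muE]] := content_radon_measure hE lE lamP.
exists (fun x : E => Delta x.2); last first.
 apply: (open_comp (f := snd : E -> G) (D := [set s | Delta s = 1%R])) => // x _.
  exact: (product_snd_continuous tauP).
exists muE.
  split => //.
  - move=> x B mB; rewrite !muEE.
    rewrite (@outer_content_image R E lam _ (fun y => (x^-1 * y)%g) 1) ?mul1e //.
    + by move=> y; rewrite mulKg.
    + by move=> y; rewrite mulVKg.
    + exact: mulgl_continuous.
    + exact: mulgl_continuous.
    + move=> K /cE cK; rewrite mul1e;
      apply: (twisted_integral_mull muA_inv muG_inv tG).
      * by move=> s; exact: compact_fiber_borel.
      * exact: compact_fiber_measurable.
  - have [C [cC C1 mC /andP[C0 Coo]]] := haar_compact_nbhd lcG muGH.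
    have cTC : @compact E (setT `*` C) by apply/(product_compact tauP);
      exact: compact_setX.
    rewrite gt_eqF //; apply: (@lt_le_trans _ _ (lam (setT `*` C))).
      by rewrite /lam product_content_setX // mule_gt0.
    apply: le_trans (lam_muE _ cTC) _; apply: borel_measure_le => //.
      exact: compact_borel.
    by apply: open_borel; exact: openT.
move=> x B mB; rewrite !muEE.
rewrite (@outer_content_image R E lam _ (fun y => (y * x^-1)%g) (Delta x.2)) //.
- by move=> y; rewrite mulgK.
- by move=> y; rewrite mulgVK.
- exact: mulgr_continuous.
- exact: mulgr_continuous.
- exact: (modular_gt0 lcG muGH DeltaE).
- move=> K /cE cK; apply: (twisted_integral_mulr muA_inv _ _ _ lcG muGH DeltaE).
  + by move=> s; exact: compact_fiber_borel.
  + exact: compact_fiber_measurable.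
Qed.

(** Tube lemma along the compact factor [A]. It provides the open sets for outer regularity of the
    image measure. *)
Lemma open_fiber_full (V : set E) : open V -> open [set s : G | forall a : A,
  V (a, s)].
Proof.
move=> oV; rewrite openE => s Vs.
have /compact_near_coveringP cA' := cA.
have := cA' G (nbhs s) (fun t a => V (a, t)) _; rewrite /interior => h.
have : \forall t \near s, [set: A] `<=` (fun a => V (a, t)).
  apply: h => a _; have /(product_nbhs tauP)[[U W] /= [aU sW] UWV] : nbhs ((a,
    s) : E) V.
    by apply: open_nbhs_nbhs; split => //; exact: Vs.
  by exists (U, W) => // -[b t] /= [Ub Wt]; exact: (UWV (b, t)).
by apply: filterS => t Vt a; exact: Vt.
Qed.

Lemma almost_unimodular_quotient : almost_unimodular R E -> almost_unimodular R G.
Proof.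
move=> [Delta [muE muEH DeltaE] oker].
have [[muE_fin outer_reg inner_reg] muE_inv muE_neq0] := muEH.
have snd_cont : continuous (snd : E -> G) := product_snd_continuous tauP.
have msnd : measurable_fun setT (snd : borel_group E -> borel_group G).
  apply: measurable_fun_openP => U oU; apply: open_borel.
  by apply: open_comp => // x _; exact: snd_cont.
(* The image of [muE] under the projection is the candidate Haar measure of [G]; compactness of [A]
   keeps it finite on compact sets. *)
have [muG muGE'] := pushforward_measureP muE msnd.
have muGE (B : set G) : muG B = muE (setT `*` B).
  by rewrite muGE'; congr (muE _); apply/seteqP; split=> -[a s] // [].
have bT (B : set G) : borel B -> @borel E (setT `*` B).
  move=> mB; have := borel_preimage snd_cont mB.
  by congr borel; apply/seteqP; split=> -[a s] // [].
have oT (U : set G) : open U -> @open E (setT `*` U).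
  move=> oU; have -> : setT `*` U = (snd : E -> G) @^-1` U.
    by apply/seteqP; split=> -[a s] // [].
  by apply: open_comp => // x _; exact: snd_cont.
(* The section [s -> (0, s)] is continuous, though not a homomorphism in general; this suffices to
   pull the open kernel back. *)
exists (fun s : G => Delta ((0%R, s) : E)); last first.
  apply: (open_comp (f := fun s : G => ((0%R,
    s) : E)) (D := [set x | Delta x = 1%R])) => // s _.
  by apply: (product_cvg_pair tauP) => //; exact: cvg_cst.
exists muG; last first.
  move=> s B mB; rewrite !muGE -DeltaE; last exact: bT.
  by rewrite (setX_mulr (omega := omega)).
split.
- split.
  + move=> K cK; rewrite muGE; apply: muE_fin; apply/(product_compact tauP).
    exact: compact_setX.
  + move=> B mB; apply/eqP; rewrite eq_le; apply/andP; split.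
      apply: le_ereal_inf_tmp => _ [U [oU BU] <-].
      by apply: borel_measure_le => //; exact: open_borel.
    rewrite muGE outer_reg; last exact: bT.
    apply: le_ereal_inf_tmp => _ [V [oV BV] <-].
    (* [V] is shrunk to the union of the fibers it contains entirely; this still contains every
       fiber over [B]. *)
    apply: ge_ereal_inf; exists (muG [set s : G | forall a : A, V (a, s)]).
      exists [set s : G | forall a : A, V (a, s)] => //; split.
        exact: open_fiber_full.
      by move=> s Bs a; apply: BV.
    rewrite muGE; apply: borel_measure_le.
    * by apply: bT; apply: open_borel; exact: open_fiber_full.
    * exact: open_borel.
    * by move=> -[a s] [_ /= Vs]; exact: Vs.
  + move=> U oU; apply/eqP; rewrite eq_le; apply/andP; split; last first.
      apply: ge_ereal_sup => _ [K [cK KU] <-].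
      by apply: borel_measure_le => //; [exact: compact_borel|exact: open_borel].
    rewrite muGE inner_reg; last exact: oT.
    apply: ge_ereal_sup => _ [K [cK KU] <-].
    have cK2 : compact ((snd : E -> G) @` K).
      by apply: continuous_compact => //; exact: continuous_subspaceT.
    (* [K] is enlarged to the union of all fibers over its compact projection, which stays inside
       [U]. *)
    apply: le_ereal_sup_tmp; exists (muG ((snd : E -> G) @` K)).
      by exists ((snd : E -> G) @` K) => //; split => // _ [x /KU[_ Ux] <-].
    rewrite muGE; apply: borel_measure_le.
    * exact: compact_borel.
    * by apply: bT; exact: compact_borel.
    * by move=> -[a s] Kas; split => //; exists (a, s).
- move=> s B mB; rewrite !muGE.
  have := muE_inv ((0%R, s) : E) _ (bT _ mB).
  by rewrite (setX_mull (omega := omega)).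
- by rewrite muGE setXTT.
Qed.

End continuous_cocycle.

Theorem proposition2p4 (R : realType)
  (G : preTopologicalGroupType) (A : topologicalZmodType)
  (hG : locally_compact_group G)
  (hausdorffA : hausdorff_space A) (compactA : compact [set: A])
  (omega : normalized_borel_cocycle G A)
  (tau : topology (twisted_product omega))
  (htau : (continuous omega /\ is_product_topology tau) \/
     [/\ @second_countable G, @second_countable A & is_mackey_topology tau]) :
  almost_unimodular R G <-> almost_unimodular R (topologized tau).
Proof.
case: htau => [[omega_cont tauP]|[scG _ tauM]].
  split; first exact: product_almost_unimodular.
  exact: almost_unimodular_quotient.
exact: mackey_almost_unimodular.
Qed.
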